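(* Consider the TSP instance $G_1$ on $V=\{1,\dots,n\}$ with $d(\{i,i+1\})=1$ for $i=1,\dots,n-1$, $d(\{n,1\})=1$, and $d(e)=n$ for all other edges; its unique optimal Hamiltonian cycle is $s^*=(1,2,\dots,n)$. Run the cross-entropy algorithm described in the context (with $M=1$, $\rho=1$, $\pi_{\min}=\frac{1}{n(n-2)}$, $\pi_{\max}=1-\frac1n$) with a sample size $N\in\Omega(n^{\epsilon})$ for some constant $\epsilon\in(0,1)$. Then, as $n\to\infty$: (a) with the vertex-based random solution generation, the algorithm finds $s^*$ within $n^6$ iterations with probability $1-e^{-\Omega(N)}$; (b) with the edge-based random solution generation, the algorithm finds $s^*$ within $n^3\ln n$ iterations with probability $1-e^{-\Omega(N)}$.
   Context: Let $K_n$ be the complete graph on $V=\{1,\dots,n\}$ with edge set $E$ of all 2-element subsets. A feasible solution is a Hamiltonian cycle of $K_n$; its cost $f(s)$ is the sum of $d$ over its $n$ edges. For a Hamiltonian cycle $H$, let $\Pi^H=(\pi_{i,j})$ be the symmetric $n\times n$ matrix with $\pi_{i,i}=0$, $\pi_{i,j}=\pi_{\max}=1-\frac1n$ if $\{i,j\}\in H$ and $\pi_{i,j}=\pi_{\min}=\frac{1}{n(n-2)}$ otherwise. Vertex-based generation from $\Pi$: pick a start vertex uniformly at random; while unvisited vertices remain, from the current vertex $v$ move to an unvisited $v'$ chosen with probability $\pi_{v,v'}/\sum_{k\text{ unvisited}}\pi_{v,k}$; output the resulting Hamiltonian cycle. Edge-based generation from $\Pi$: start with $B=\emptyset$ and repeatedly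 add an edge $\{i,j\}\notin B$ chosen among admissible edges with probability proportional to $\pi_{i,j}+\pi_{j,i}$, until $B$ is a Hamiltonian cycle; an edge is admissible if adding it creates no vertex of degree $\ge3$ and no cycle with fewer than $n$ edges. The algorithm: $\Pi_0$ has all off-diagonal entries $\frac1{n-1}$. In iteration $t=0,1,2,\dots$, generate $N$ independent solutions from $\Pi_t$, let $X_t^{[1]}$ be one of minimum cost, and set $\Pi_{t+1}=\Pi^{X_t^{[1]}}$. The optimal solution is found within $T$ iterations if $X_t^{[1]}$ is optimal for some $t\le T$. Asymptotics are as $n\to\infty$ with $N=N(n)$. *)

(* Defs.v *)
From HB Require Import structures.
From mathcomp Require Import all_boot all_order all_algebra fingroup perm.
From mathcomp Require Import all_classical all_reals all_analysis.
Unset Printing Implicit Defensive.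
Import Order.TTheory GRing.Theory Num.Theory.
Local Open Scope ring_scope.

Section CE.
Variable R : realType.
Variable n : nat.

Notation V := ('I_n).
Notation edge := {set 'I_n}.
Notation esol := {set {set 'I_n}}.

Definition pmat := V -> V -> R.

Definition cyc_edges k (f : 'I_k -> V) : esol :=
  [set [set f i; f (ordS i)] | i : 'I_k].

Definition is_cycle (C : esol) : bool :=
  [exists k : 'I_n.+1, [exists f : {ffun 'I_k -> V},
     (2 < k)%N && injectiveb f && (C == cyc_edges k f)]].

Definition is_ham (H : esol) : Prop :=
  (2 < n)%N /\ exists s : {perm V}, H = cyc_edges n s.

(* distances of instance G_1 (vertices 0..n-1 instead of 1..n) *)
Definition dG1 (e : edge) : R :=
  if [exists i : V, exists j : V, (e == [set i; j]) && ((i.+1 %% n)%N == j)]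
  then 1 else n%:R.

Definition cost (H : esol) : R := \sum_(e in H) dG1 e.

Definition optimal (H : esol) : Prop :=
  is_ham H /\ forall H', is_ham H' -> cost H <= cost H'.

Definition pi_min : R := 1 / (n%:R * (n%:R - 2)).
Definition pi_max : R := 1 - 1 / n%:R.

Definition Pi0 : pmat := fun i j => if i == j then 0 else 1 / (n%:R - 1).

Definition PiH (H : esol) : pmat := fun i j =>
  if i == j then 0 else if [set i; j] \in H then pi_max else pi_min.

Definition vprob (P : pmat) (s : {perm V}) : R :=
  (1 / n%:R) *
  \prod_(k : V | (0 < k)%N)
     (P (s (ord_pred k)) (s k) /
      \sum_(j : V | (k <= j)%N) P (s (ord_pred k)) (s j)).

Definition vgen (P : pmat) (H : esol) : R :=
  \sum_(s : {perm V} | cyc_edges n s == H) vprob P s.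

Definition deg (B : esol) (v : V) : nat := #|[set e in B | v \in e]|.

Definition admissible (B : esol) (e : edge) : bool :=
  [&& #|e| == 2%N, e \notin B,
      [forall v, (deg (e |: B) v <= 2)%N] &
      ~~ [exists C : esol, [&& C \subset e |: B, e \in C, is_cycle C & (#|C| < n)%N]]].

Definition eweight (P : pmat) (e : edge) : R :=
  \sum_(i : V) \sum_(j : V | (i != j) && (e == [set i; j])) P i j.

Definition prefix (s : {ffun V -> edge}) (k : nat) : esol :=
  [set s i | i : V & (i < k)%N].

Definition eprob (P : pmat) (s : {ffun V -> edge}) : R :=
  \prod_(k : V)
    (if admissible (prefix s k) (s k)
     then eweight P (s k) /
          \sum_(f : edge | admissible (prefix s k) f) eweight P f
     else 0).

Definition egen (P : pmat) (H : esol) : R :=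
  \sum_(s : {ffun V -> edge} | prefix s n == H) eprob P s.

Definition sel_ok (N : nat) (sel : N.-tuple esol -> esol) : Prop :=
  forall t : N.-tuple esol, (0 < N)%N ->
    sel t \in t /\ forall x, x \in t -> cost (sel t) <= cost x.

(* probability that, starting iteration 0 from matrix P, an optimal X_t^[1]
   is obtained for some t <= T *)
Fixpoint find_prob (gen : pmat -> esol -> R) (N : nat)
   (sel : N.-tuple esol -> esol) (T : nat) (P : pmat) : R :=
  \sum_(t : N.-tuple esol)
    (\prod_(i < N) gen P (tnth t i)) *
    (if `[< optimal (sel t) >] then 1
     else match T with
          | 0%N => 0
          | T'.+1 => find_prob gen N sel T' (PiH (sel t))
          end).

End CE.

(* Main.v *)
Require Import Defs.
From mathcomp Require Import all_boot all_order all_algebra fingroup perm.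
From mathcomp Require Import all_classical all_reals all_analysis.
From mathcomp Require Import zify ring lra.
From mathcomp Require Import ssrbool eqtype ssrnat seq path choice fintype finfun bigop finset.
Set Implicit Arguments.
Unset Strict Implicit.
Unset Printing Implicit Defensive.
Import Order.TTheory GRing.Theory Num.Theory.
Local Open Scope ring_scope.

(** Let the level of a tour be the number of its edges outside the optimal tour. With
constant probability a sample drawn from the matrix of the tour [H] is [H] itself, so up to
an error exponentially small in [N] the level never increases.

If [e = {u, v}] is an optimal edge missing from [H], then two non-optimal edges of [H] at [u]
and at [v], and possibly a third one, can be exchanged for [e] and at most two further edges
(a 2-opt or a 3-opt move). The vertex-based generation takes such a tour with probability of
order [n^-5], by starting in [v] and closing the tour with [e]. In the edge-based generation,
when [m] edges are missing, the edges to be exchanged are still untouched with probability of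
order [(m/n)^3], [e] is then chosen with probability of order [1/(n^2 m)], and the rest is
completed as wanted with probability of order [1/m]; summing over [m] gives order [n^-3] for
each of the [k] missing optimal edges, hence [k/n^3] altogether.

Spending [n^5], respectively [n^3/(2k)], iterations on level [k] leaves every level except with
probability exponentially small in [N], and these budgets add up to at most [n^6],
respectively [n^3 ln n]. *)

(** * Hamiltonian cycles *)

(** The exchange protects the optimal edges already in [H]: only non-optimal edges are given up, so
    gaining [e] lowers the level. This is why 2-opt does not always suffice. When the unprotected
    edges at [u] and [v] point in opposite directions along [H], dropping them and adding [e] closes
    a cycle that misses some vertices; as the optimal tour contains no such cycle, some other edge
    of it is unprotected and can be cut as well.

    The constant probability of reproducing [H] comes from the weights. An edge outside [H] weighs
    [1 / ((n - 1) (n - 2))] of an edge of [H], so all such edges together change the normalisation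
    of a step by a factor [1 + O(1 / n)], and the product over [n] steps stays bounded. This yields
    [expR (- 8)] and [expR (- 2)].

    If a sample improves a tour with probability [p] and [L] iterations are spent on its level with
    [p * L >= c2], then all [N * L] samples fail with probability at most [expR (- c2 * N)]. The
    polynomially many error terms of this kind are absorbed because [N] is at least of order
    [n ^ eps]. *)

Section HamiltonianCycles.
Local Open Scope nat_scope.
Variable n : nat.
Implicit Types (u v x y : 'I_n) (p c : seq 'I_n) (e : {set 'I_n}) (B H : {set {set 'I_n}}).

(** Tours are treated as vertex lists, so that 2-opt and 3-opt moves become rearrangements of list
    segments; [is_ham_list] and [is_ham_cycle_edges] translate from and to [is_ham]. *)
Fixpoint path_edges x p : {set {set 'I_n}} :=
  if p is y :: p' then [set x; y] |: path_edges y p' else set0.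

Definition cycle_edges x p := [set last x p; x] |: path_edges x p.

Lemma path_edges_cat x p1 p2 :
  path_edges x (p1 ++ p2) = path_edges x p1 :|: path_edges (last x p1) p2.
Proof.
elim: p1 x => [|y p1 IH] x /=; first by rewrite set0U.
by rewrite IH setUA.
Qed.

Lemma path_edges_rcons x p y :
  path_edges x (rcons p y) = [set last x p; y] |: path_edges x p.
Proof. by rewrite -cats1 path_edges_cat /= setU0 setUC. Qed.

Lemma last_rev_belast x p : last (last x p) (rev (belast x p)) = x.
Proof. by case: p => //= y p; rewrite rev_cons last_rcons. Qed.

Lemma path_edges_rev x p : path_edges (last x p) (rev (belast x p)) = path_edges x p.
Proof.
elim: p x => [|y p IH] x //=.
by rewrite rev_cons path_edges_rcons IH last_rev_belast [[set y; x]]setUC.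
Qed.

Lemma path_edgesP x p e :
  reflect (exists p1 y p2, p = p1 ++ y :: p2 /\ e = [set last x p1; y])
          (e \in path_edges x p).
Proof.
apply: (iffP idP) => [|[p1 [y [p2 [-> ->]]]]].
  elim: p x => [|y p IH] x /=; first by rewrite inE.
  rewrite in_setU1 => /orP[/eqP ->|/IH[p1 [z [p2 [-> ->]]]]].
    by exists [::], y, p.
  by exists (y :: p1), z, p2.
by rewrite path_edges_cat /= !in_setU !in_set1 eqxx !orbT.
Qed.

Lemma cycle_edges_rcons x p : cycle_edges x p = path_edges x (rcons p x).
Proof. by rewrite path_edges_rcons. Qed.

Lemma cycle_edges_swap u v p1 p2 :
  cycle_edges u (p1 ++ v :: p2) = cycle_edges v (p2 ++ u :: p1).
Proof.
rewrite !cycle_edges_rcons !rcons_cat !rcons_cons !path_edges_cat /=.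
rewrite !path_edges_rcons.
apply/setP => e; rewrite !in_setU.
by do 4![case: (e \in _) => //=].
Qed.

Lemma cycle_edges_rev u p : cycle_edges u (rev p) = cycle_edges u p.
Proof.
rewrite !cycle_edges_rcons -[RHS]path_edges_rev last_rcons belast_rcons.
by rewrite rev_cons.
Qed.

(** At [i = size p] the second [nth] runs off the list and returns its default [x], which gives the
    closing edge. *)
Lemma cycle_edgesP x p e :
  reflect (exists2 i, i <= size p & e = [set nth x (x :: p) i; nth x p i])
          (e \in cycle_edges x p).
Proof.
have path_nth d y q : reflect (exists2 i, i < size q & d = [set nth x (y :: q) i; nth x q i])
          (d \in path_edges y q).
  apply: (iffP idP) => [|[i + ->]].
    elim: q y => [|z q IH] y /=; first by rewrite inE.
    rewrite in_setU1 => /orP[/eqP ->|/IH[i ilt ->]]; first by exists 0.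
    by exists i.+1.
  elim: q i y => [|z q IH] [|i] y //= ilt; first by rewrite setU11.
  by rewrite in_setU1 IH // orbT.
rewrite in_setU1; apply: (iffP orP) => [[/eqP ->|/path_nth[i ilt ->]]|[i ile ->]].
- by exists (size p); rewrite // (nth_last x (x :: p)) /= [nth _ p _]nth_default.
- by exists i; rewrite // ltnW.
- move: ile; rewrite leq_eqVlt => /orP[/eqP ->|ilt].
    by left; rewrite (nth_last x (x :: p)) /= [nth _ p _]nth_default.
  by right; apply/path_nth; exists i.
Qed.

Lemma cyc_edges_nth k x p : size (x :: p) = k ->
  cyc_edges n k (fun i => nth x (x :: p) i) = cycle_edges x p.
Proof.
move=> sz; have sz' : (size p).+1 = k := sz.
have step (i : 'I_k) : nth x (x :: p) (ordS i) = nth x p i.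
  have ile : i <= size p by rewrite -ltnS sz'.
  have -> : nat_of_ord (ordS i) = i.+1 %% (size p).+1 by rewrite sz'.
  move: ile; rewrite leq_eqVlt => /orP[/eqP ->|ilt].
    by rewrite modnn /= nth_default.
  by rewrite modn_small.
apply/setP => e; apply/imsetP/cycle_edgesP => [[i _ ->]|[i ile ->]].
  by exists i; rewrite ?step // -ltnS sz'.
have iltk : i < k by rewrite -sz'.
by exists (Ordinal iltk); rewrite ?step.
Qed.

Lemma card_cycle_edges_le x p : #|cycle_edges x p| <= (size p).+1.
Proof.
rewrite -(@cyc_edges_nth (size p).+1 x p) // -[X in _ <= X]card_ord.
exact: leq_imset_card.
Qed.

Lemma is_cycle_cycle_edges x p : 1 < size p < n -> uniq (x :: p) ->
  is_cycle n (cycle_edges x p).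
Proof.
move=> /andP[p1 pn] up; apply/existsP.
have kn : size (x :: p) < n.+1 by [].
exists (Ordinal kn); apply/existsP; exists [ffun i : 'I_(Ordinal kn) => nth x (x :: p) i].
apply/andP; split; first (apply/andP; split=> //).
  by apply/injectiveP => i j; rewrite !ffunE => /eqP; rewrite nth_uniq // => /eqP/val_inj.
rewrite -(@cyc_edges_nth (Ordinal kn) x p) //; apply/eqP/eq_imset => i.
by rewrite !ffunE.
Qed.

Lemma is_ham_cycle_edges x p : 2 < n -> uniq (x :: p) -> size (x :: p) = n ->
  is_ham n (cycle_edges x p).
Proof.
move=> n2 up sz; split=> //.
have finj : injective (fun i : 'I_n => nth x (x :: p) i).
  by move=> i j /eqP; rewrite nth_uniq ?sz // => /eqP/val_inj.
exists (perm finj); rewrite -(cyc_edges_nth sz).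
by apply: eq_imset => i; rewrite !permE.
Qed.

Lemma cycle_edges_of_perm (s : {perm 'I_n}) u :
  exists p, [/\ uniq (u :: p), size (u :: p) = n & cyc_edges n n s = cycle_edges u p].
Proof.
case En: (map s (enum 'I_n)) => [|x p].
  by move/(congr1 size): En; rewrite size_map size_enum_ord => /= n0; have := ltn_ord u; rewrite [X in _ < X]n0.
have sz : size (x :: p) = n by rewrite -En size_map size_enum_ord.
have up : uniq (x :: p) by rewrite -En map_inj_uniq ?enum_uniq //; exact: perm_inj.
have Es : cyc_edges n n s = cycle_edges x p.
  rewrite -(cyc_edges_nth sz).
  have nthE (i : 'I_n) : nth x (x :: p) i = s i.
    by rewrite -En (nth_map i) ?size_enum_ord // nth_ord_enum.
  by apply: eq_imset => i; rewrite -!nthE.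
have : u \in x :: p.
  by rewrite -En; apply/mapP; exists ((s^-1)%g u); rewrite ?mem_enum ?permKV.
rewrite inE => /orP[/eqP ->|]; first by exists p.
move=> up'; case/path.splitPr: up' sz up Es {En} => p1 p2 sz up Es.
exists (p2 ++ x :: p1); split; last by rewrite Es cycle_edges_swap.
  by rewrite -cat_cons uniq_catC.
by rewrite -cat_cons size_cat addnC -size_cat.
Qed.

Lemma is_ham_list H u : is_ham n H ->
  exists p, [/\ uniq (u :: p), size (u :: p) = n & H = cycle_edges u p].
Proof. by case=> _ [s ->]; exact: cycle_edges_of_perm. Qed.

(** Here the length above 2 enters: otherwise the two edges at a vertex of a cycle could
    coincide. *)
Lemma ordS2_neq k (i : 'I_k) : 2 < k -> ordS (ordS i) != i.
Proof.
move=> k2; apply/negP => /eqP/(congr1 val) /=.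
have ik := ltn_ord i; rewrite -[(_ %% k).+1]addn1 modnDml addn1 => E.
have [lt|ge] := ltnP i.+2 k; first by move: E; rewrite modn_small //; lia.
move: E; rewrite -{1}(subnKC ge) modnDl modn_small; lia.
Qed.

Lemma cyc_edge_inj k (f : 'I_k -> 'I_n) : injective f -> 2 < k ->
  injective (fun i => [set f i; f (ordS i)]).
Proof.
move=> fi k2 i j /setP E.
have := E (f i); rewrite !inE eqxx /= => /esym/orP[/eqP/fi //|/eqP/fi ij].
have := E (f j); rewrite !inE eqxx /= => /orP[/eqP/fi //|/eqP/fi ji].
by have := ordS2_neq i k2; rewrite -ji -ij eqxx.
Qed.

Lemma card_cyc_edges k (f : 'I_k -> 'I_n) : injective f -> 2 < k ->
  #|cyc_edges n k f| = k.
Proof. by move=> fi k2; rewrite card_imset ?card_ord //; exact: cyc_edge_inj. Qed.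

Lemma cyc_edges_at k (f : 'I_k -> 'I_n) i e : injective f ->
  e \in cyc_edges n k f -> f i \in e ->
  e = [set f i; f (ordS i)] \/ e = [set f (ord_pred i); f i].
Proof.
move=> fi /imsetP[j _ ->]; rewrite !inE => /orP[/eqP/fi ->|/eqP/fi ->]; [by left|right].
by rewrite ordSK.
Qed.

Lemma is_ham_card H : is_ham n H -> #|H| = n.
Proof. by case=> n2 [s ->]; apply: card_cyc_edges => //; exact: perm_inj. Qed.

Lemma is_ham_gt2 H : is_ham n H -> 2 < n.
Proof. by case. Qed.

Lemma is_ham_edge2 H e : is_ham n H -> e \in H -> #|e| = 2.
Proof.
case=> n2 [s ->] /imsetP[i _ ->]; rewrite cards2 (inj_eq perm_inj).
case: eqP => // E; have := ordS2_neq i n2.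
by rewrite -E -E eqxx.
Qed.

Lemma is_ham_deg H v : is_ham n H -> deg n H v <= 2.
Proof.
case=> n2 [s ->]; rewrite /deg -(permKV s v); set i := (s^-1)%g v.
apply: leq_trans (_ : #|[set [set s i; s (ordS i)]; [set s (ord_pred i); s i]]| <= _); last first.
  by rewrite cards2; case: (_ != _).
apply/subset_leq_card/subsetP => e; rewrite inE => /andP[eH ve].
by rewrite !inE; case: (cyc_edges_at (@perm_inj _ s) eH ve) => ->; rewrite eqxx ?orbT.
Qed.

(** A vertex of [C] has two distinct edges in [C], and these are its only two edges in [H]. So the
    vertices of [C] are closed under the successor along [s], and [C] visits all of them. *)
Lemma is_ham_no_subcycle H C : is_ham n H -> is_cycle n C -> C \subset H -> n <= #|C|.
Proof.
case=> n2 [s ->] /existsP[k /existsP[f /andP[/andP[k2 /injectiveP fi] /eqP ->]]] sub.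
rewrite card_cyc_edges //.
have clos a : s a \in codom f -> s (ordS a) \in codom f.
  case/codomP => i fia.
  pose E b := [set s b; s (ordS b)].
  have Cin j : [set f j; f (ordS j)] \in cyc_edges n k f by apply/imsetP; exists j.
  have at_a e : e \in cyc_edges n k f -> f i \in e -> e = E a \/ e = E (ord_pred a).
    move/(subsetP sub) => eH ie; rewrite /E ord_predK.
    by apply: cyc_edges_at eH _; rewrite ?fia //; exact: perm_inj.
  have inC : E a \in cyc_edges n k f.
    have h1 := at_a _ (Cin i) (set21 _ _).
    have h2 := at_a _ (Cin (ord_pred i)); rewrite ord_predK set22 in h2.
    case: h1 => [<-|h1]; first exact: Cin.
    case: (h2 isT) => [<-|h3]; first by have := Cin (ord_pred i); rewrite ord_predK.
    have /(cyc_edge_inj fi k2) ii : [set f (ord_pred i); f (ordS (ord_pred i))] = [set f i; f (ordS i)].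
      by rewrite ord_predK h1 h3.
    have := ordS2_neq (ord_pred i) k2.
    by rewrite ord_predK -{1}ii ord_predK ii eqxx.
  case/imsetP: inC => j _ Ej.
  have : s (ordS a) \in E a by rewrite !inE eqxx orbT.
  by rewrite Ej !inE => /orP[]/eqP ->; rewrite codom_f.
have iterS m (a : 'I_n) : val (iter m (@ordS n) a) = (a + m) %% n.
  elim: m => [|m IH]; first by rewrite addn0 modn_small.
  by rewrite iterS /= IH -[X in X %% _ = _]addn1 modnDml addn1 addnS.
have all b : s b \in codom f.
  have k0 : 0 < k by apply: leq_trans k2.
  pose a := (s^-1)%g (f (Ordinal k0)).
  (* This many successor steps lead from [a] to [b] modulo [n]; the summand [n] prevents truncated
     subtraction. *)
  have -> : b = iter (b + n - a) (@ordS n) a.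
    apply/val_inj; rewrite iterS subnKC; last by have := ltn_ord a; lia.
    by rewrite modnDr modn_small.
  elim: (_ - _) => [|m IH] /=; last exact: clos.
  by rewrite /a permKV codom_f.
have sub' : codom s \subset codom f by apply/subsetP => _ /codomP[b ->].
have := leq_trans (subset_leq_card sub') (leq_image_card f predT).
by rewrite (card_codom (@perm_inj _ s)) !card_ord.
Qed.

Lemma admissible_sub_ham H B e : is_ham n H -> e |: B \subset H -> e \notin B ->
  admissible n B e.
Proof.
move=> hH sub eB; have eH : e \in H by apply: (subsetP sub); rewrite setU11.
apply/and4P; split=> //; first by rewrite (is_ham_edge2 hH eH).
  apply/forallP => v; apply: leq_trans (is_ham_deg v hH).
  apply/subset_leq_card/subsetP => d; rewrite !inE => /andP[dB ->]; rewrite andbT.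
  by apply: (subsetP sub); rewrite !inE.
apply/negP => /existsP[C /and4P[CB _ Ccyc]].
by rewrite ltnNge (is_ham_no_subcycle hH Ccyc) // (subset_trans CB).
Qed.

(* [r] visits all vertices from [v] to [u]; with the edge [{u, v}] it closes to a
   Hamiltonian cycle that keeps all of [H] but the edges [a], [b], [g]. *)
Definition exchange_spec H B u v (a b g a' b' : {set 'I_n}) (r : seq 'I_n) :=
  let K := H :\: [set a; b; g] in
  [/\ [/\ a \in H :\: B, b \in H :\: B & g \in H :\: B],
      [/\ u \in a, u \in a', v \in b & v \in b'],
      [/\ a' \in K, b' \in K & a' != b'] &
      [/\ uniq (v :: r), size (v :: r) = n, last v r = u & K \subset path_edges v r]].

(** Vertex order of the 2-opt move: the segment [p] between [u] and [v] is traversed backwards. *)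
Lemma perm_reversed_first u v p q :
  perm_eq (u :: p ++ v :: q) (v :: rev p ++ rcons q u).
Proof.
apply/permP => t; rewrite -cats1 /= !count_cat /= ?count_cat ?count_rev /=; lia.
Qed.

(** Vertex order of the 3-opt move: [p] is inserted, unreversed, where the segment from [v] back to
    [u] is cut. *)
Lemma perm_first_inside u v p q1 q2 q : rcons q u = q1 ++ q2 ->
  perm_eq (u :: p ++ v :: q) (v :: q1 ++ p ++ q2).
Proof.
move=> E; apply/permP => t; move/(congr1 (count t)): E.
rewrite -cats1 /= !count_cat /= ?count_cat /=; lia.
Qed.

(** The tour reads [u, x1, ..., y1, v, x2, ..., y2]. If [{u, x1}] and [{v, x2}] are both outside
    [B], they are exchanged for [{u, v}] and [{x1, x2}] (2-opt). Otherwise [{u, x1}] and [{y1, v}]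
    are dropped, the segment from [v] to [u] is cut at a further edge [g] outside [B], and
    [x1, ..., y1] is inserted there (3-opt). *)
Lemma exchange_oriented H B u v x1 p1 x2 p2 :
  let y1 := last x1 p1 in let y2 := last x2 p2 in
  B \subset H -> admissible n B [set u; v] ->
  uniq (u :: (x1 :: p1) ++ v :: x2 :: p2) -> size (u :: (x1 :: p1) ++ v :: x2 :: p2) = n ->
  H = cycle_edges u ((x1 :: p1) ++ v :: x2 :: p2) ->
  [set u; x1] \notin B ->
  [set v; x2] \notin B \/
    [/\ [set y1; v] \notin B, [set y2; u] \in B & [set v; x2] \in B] ->
  exists a b g a' b' r, exchange_spec H B u v a b g a' b' r.
Proof.
move=> y1 y2 BH adm up sz EH a1B.
have y1p : y1 \in x1 :: p1 by rewrite mem_last.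
have y2p : y2 \in x2 :: p2 by rewrite mem_last.
have x1p := mem_head x1 p1; have x2p := mem_head x2 p2.
have EH' : H = [set y2; u] |: ([set u; x1] |: (path_edges x1 p1 :|:
    ([set y1; v] |: ([set v; x2] |: path_edges x2 p2)))).
  by rewrite EH /cycle_edges /= last_cat /= path_edges_cat.
have dis w w' : w \in x1 :: p1 -> w' \in x2 :: p2 ->
    [/\ w != u, w != v, w' != u, w' != v & w != w'].
  move: up; rewrite cons_uniq cat_uniq mem_cat negb_or => /andP[/andP[u1]].
  rewrite in_cons negb_or => /andP[_ u2] /and3P[_ /hasPn nh].
  rewrite cons_uniq => /andP[v2 _] w1 w2.
  split; apply/negP => /eqP E.
  - by rewrite -E w1 in u1.
  - by have := nh v (mem_head _ _); rewrite /= -E w1.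
  - by rewrite -E w2 in u2.
  - by rewrite -E w2 in v2.
  - by have := nh w'; rewrite inE w2 orbT => /(_ isT) /=; rewrite -E w1.
have uv : u != v by move: up; rewrite cons_uniq mem_cat (in_cons v) !negb_or => /andP[/andP[_ /andP[]]].
have [d1 d2 d3 d4 d5] := dis _ _ y1p y2p.
have [d1' d2' _ _ d5'] := dis _ _ x1p y2p.
have [_ _ d3' d4' d5''] := dis _ _ y1p x2p.
have ne (w : 'I_n) (S T : {set 'I_n}) : w \in S -> w \notin T -> S != T.
  by move=> wS; apply: contraNneq => <-.
have nE := (negbTE uv, negbTE d1, negbTE d2, negbTE d3, negbTE d4, negbTE d5, negbTE d5', negbTE d5'',
            negbTE d1', negbTE d2', negbTE d3', negbTE d4').
have nE' := (nE, eq_sym u, eq_sym v, eq_sym y2, nE).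
have a2a1 : [set y2; u] != [set u; x1] by apply: (@ne y2); rewrite !inE ?eqxx //= !nE'.
have a2b2 : [set y2; u] != [set v; x2] by apply: (@ne u); rewrite !inE ?eqxx ?orbT //= !nE'.
have b1a1 : [set y1; v] != [set u; x1] by apply: (@ne v); rewrite !inE ?eqxx ?orbT //= !nE'.
have b1b2 : [set y1; v] != [set v; x2] by apply: (@ne y1); rewrite !inE ?eqxx //= !nE'.
have a2b1 : [set y2; u] != [set y1; v] by apply: (@ne u); rewrite !inE ?eqxx ?orbT //= !nE'.
have a2H : [set y2; u] \in H by rewrite EH' setU11.
have a1H : [set u; x1] \in H by rewrite EH' in_setU1 setU11 orbT.
have b1H : [set y1; v] \in H by rewrite EH' !in_setU !in_set1 eqxx !orbT.
have b2H : [set v; x2] \in H by rewrite EH' !in_setU !in_set1 eqxx !orbT.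
have pm r : perm_eq (u :: (x1 :: p1) ++ v :: x2 :: p2) (v :: r) ->
    uniq (v :: r) /\ size (v :: r) = n.
  by move=> p; rewrite -(perm_uniq p) -(perm_size p).
case=> [b2B|[b1B a2B b2B]].
  (* Only two edges are removed in this case, so [g] repeats [a]. *)
  exists [set u; x1], [set v; x2], [set u; x1], [set y2; u], [set y1; v].
  exists (rev (x1 :: p1) ++ rcons (x2 :: p2) u).
  split; [by rewrite !inE a1B a1H b2B b2H | by rewrite !inE !eqxx !orbT | split | split].
  - by rewrite !in_setD a2H !in_setU !in_set1 !negb_or a2a1 a2b2.
  - by rewrite !in_setD b1H !in_setU !in_set1 !negb_or b1a1 b1b2.
  - by [].
  - exact: (proj1 (pm _ (perm_reversed_first _ _ _ _))).
  - exact: (proj2 (pm _ (perm_reversed_first _ _ _ _))).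
  - by rewrite last_cat last_rcons.
  have Ev : path_edges v (rev (x1 :: p1)) = path_edges x1 (rcons p1 v).
    by rewrite -[RHS]path_edges_rev last_rcons belast_rcons.
  rewrite path_edges_cat Ev path_edges_rcons rev_cons last_rcons rcons_cons /= path_edges_rcons.
  apply/subsetP => e; rewrite EH' !in_setD !in_setU !in_set1.
  move: (e == [set u; x1]) (e == [set v; x2]) (e == [set y2; u]) (e == [set y1; v]).
  move: (e == [set x1; x2]) (e \in path_edges x1 p1) (e \in path_edges x2 p2).
  by clear; do 7!case.
(* If the whole segment from [v] to [u] belonged to [B], then [{u, v}] would close a cycle with
   fewer than [n] edges, against admissibility. *)
have [g gP gB] : exists2 g, g \in path_edges v (rcons (x2 :: p2) u) & g \notin B.
  apply/exists_inP; apply: contraT; rewrite negb_exists_in => /forall_inP all.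
  case/and4P: adm => _ _ _ /existsP[]; exists (cycle_edges v (rcons (x2 :: p2) u)).
  have sub : path_edges v (rcons (x2 :: p2) u) \subset B.
    by apply/subsetP => e /all; rewrite negbK.
  have uq : uniq (v :: rcons (x2 :: p2) u).
    move: up; rewrite cons_uniq mem_cat negb_or cat_uniq => /andP[/andP[_ uq] /and3P[_ _ q2]].
    by rewrite -rcons_cons rcons_uniq uq.
  have szl : 1 < size (rcons (x2 :: p2) u) < n.-1.
    by have sz' := sz; rewrite /= size_cat /= in sz'; rewrite size_rcons /=; clear -sz'; lia.
  have szc : 1 < size (rcons (x2 :: p2) u) < n by clear -szl; lia.
  rewrite (is_cycle_cycle_edges szc uq).
  apply/and3P; split.
  - by rewrite /cycle_edges last_rcons; apply: setUS.
  - by rewrite /cycle_edges last_rcons setU11.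
  - apply: leq_ltn_trans (card_cycle_edges_le _ _) _.
    by clear -szl; lia.
case/path_edgesP: gP => q1 [z [q2 [Eq Eg]]].
have EH2 : H = [set u; x1] |: (path_edges x1 p1 :|: ([set y1; v] |: (path_edges v q1 :|:
    (g |: path_edges z q2)))).
  rewrite EH cycle_edges_rcons rcons_cat path_edges_cat rcons_cons.
  rewrite Eq /= path_edges_cat /= -Eg.
  by rewrite -!setUA.
have lq : last z q2 = u by have := congr1 (last v) Eq; rewrite last_rcons last_cat.
have gH : g \in H by rewrite EH2 !in_setU !in_set1 eqxx !orbT.
exists [set u; x1], [set y1; v], g, [set y2; u], [set v; x2], (q1 ++ (x1 :: p1) ++ z :: q2).
have neB (S T : {set 'I_n}) : S \in B -> T \notin B -> S != T.
  by move=> SB; apply: contraNneq => <-.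
have pq := pm _ (perm_first_inside v (x1 :: p1) Eq).
split; [by rewrite !inE a1B b1B gB a1H b1H gH | by rewrite !inE !eqxx !orbT | split | split].
- by rewrite !in_setD a2H !in_setU !in_set1 !negb_or !neB.
- by rewrite !in_setD b2H !in_setU !in_set1 !negb_or !neB.
- by [].
- by case: pq.
- by case: pq.
- by rewrite !last_cat.
rewrite path_edges_cat /= path_edges_cat /= -/y1.
apply/subsetP => e; rewrite EH2 !in_setD !in_setU !in_set1.
move: (e == [set u; x1]) (e == [set y1; v]) (e == g) (e \in path_edges v q1).
move: (e == [set last v q1; x1]) (e \in path_edges x1 p1) (e == [set y1; z]) (e \in path_edges z q2).
by clear; do 8!case.
Qed.

Lemma mem_full_list c w : uniq c -> size c = n -> w \in c.
Proof.
move=> uc sc; have sub : {subset c <= enum 'I_n} by move=> x _; rewrite mem_enum.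
have [|_ ->] := uniq_min_size uc sub; last by rewrite mem_enum.
by rewrite size_enum_ord sc.
Qed.

Lemma admissible_deg B e w a1 a2 : admissible n B e -> w \in e ->
  a1 != a2 -> a1 \in B -> a2 \in B -> w \in a1 -> w \in a2 -> False.
Proof.
case/and4P => _ eB /forallP/(_ w) dw _ we a12 B1 B2 w1 w2.
move: dw; rewrite /deg leqNgt => /negP[].
have neB a : a \in B -> e != a by apply: contraTneq => <-.
apply: leq_trans (_ : #|[set e; a1; a2]| <= _); last first.
  apply/subset_leq_card/subsetP => x; rewrite !inE -orbA.
  by case/or3P=> /eqP ->; rewrite ?eqxx ?we ?w1 ?w2 ?B1 ?B2 ?orbT.
by rewrite -setUA cardsU1 cards2 a12 !inE negb_or !neB.
Qed.

(** By the degree condition, at most one of the two tour edges at [u] lies in [B], and likewise at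
    [v]. Either free edges at [u] and [v] point in the same direction, or they are forced to be
    opposite; up to reversing the tour, [exchange_oriented] covers both cases. *)
Lemma exchange H B u v : is_ham n H -> B \subset H -> [set u; v] \notin H ->
  admissible n B [set u; v] ->
  exists a b g a' b' r, exchange_spec H B u v a b g a' b' r.
Proof.
move=> hH BH eH adm.
have uv : u != v by case/and4P: adm => /eqP; rewrite cards2; case: eqP.
have [p [up sz EH]] := is_ham_list u hH.
have vp : v \in p.
  by have := mem_full_list v up sz; rewrite inE eq_sym (negbTE uv).
(* An empty segment would make [u] and [v] neighbours on [H], contrary to [eH]. *)
case/path.splitPr: vp up sz EH => -[|x1 p1] [|x2 p2] up sz EH; try by
  move: eH; rewrite EH /cycle_edges /= ?last_cat /= ?in_setU ?in_set1 ?[[set v; u]]setUC ?eqxx ?orbT.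
set y1 := last x1 p1; set y2 := last x2 p2.
have Ev1 : rev (x1 :: p1) = y1 :: rev (belast x1 p1) by rewrite lastI rev_rcons.
have Ev2 : rev (x2 :: p2) = y2 :: rev (belast x2 p2) by rewrite lastI rev_rcons.
have Erev : rev ((x1 :: p1) ++ v :: x2 :: p2) =
    (y2 :: rev (belast x2 p2)) ++ v :: y1 :: rev (belast x1 p1).
  by rewrite rev_cat [rev (v :: _)]rev_cons cat_rcons Ev1 Ev2.
have up' : uniq (u :: rev ((x1 :: p1) ++ v :: x2 :: p2)).
  by move: up; rewrite !cons_uniq mem_rev rev_uniq.
have sz' : size (u :: rev ((x1 :: p1) ++ v :: x2 :: p2)) = n.
  by move: sz; rewrite -size_rev rev_cons size_rcons /=.
have EH' : H = cycle_edges u (rev ((x1 :: p1) ++ v :: x2 :: p2)) by rewrite cycle_edges_rev.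
rewrite Erev in up' sz' EH'.
have fwd := exchange_oriented BH adm up sz EH.
have bwd := exchange_oriented BH adm up' sz' EH'.
rewrite !last_rev_belast -/y1 -/y2 in fwd bwd.
rewrite ![[set _; u]]setUC ![[set _; v]]setUC in fwd bwd.
have y1p : y1 \in x1 :: p1 by exact: mem_last.
have y2p : y2 \in x2 :: p2 by exact: mem_last.
have x12 : x1 != y2 /\ x2 != y1.
  move: up; rewrite cons_uniq cat_uniq => /and3P[_ _ /andP[/hasPn nh _]].
  split; apply/negP => /eqP E.
    by have := nh y2; rewrite -E mem_head in_cons E y2p orbT => /(_ isT).
  by have := nh x2; rewrite E y1p -E !in_cons eqxx orbT => /(_ isT).
have one_edge z w w' : z \in [set u; v] -> w != w' -> ~~ (([set z; w] \in B) && ([set z; w'] \in B)).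
  move=> ze ww; apply/negP => /andP[w1 w2].
  apply: (admissible_deg adm ze _ w1 w2); rewrite ?set21 //.
  apply: contraNneq ww => /setP E.
  have := E w; have := E w'; rewrite !inE !eqxx !orbT => /orP[/eqP->|/eqP-> //].
  by move/esym/orP=> [/eqP->|/eqP->].
have [x12u x12v] := x12.
have := one_edge u _ _ (set21 _ _) x12u; have := one_edge v _ _ (set22 _ _) x12v.
case: (boolP ([set u; x1] \in B)) fwd bwd => [a1 _|a1 fwd].
  case: ([set u; y2] \in B) => // bwd; case: (boolP ([set v; y1] \in B)) bwd => b1 bwd.
    by rewrite andbT => b2 _; apply: bwd => //; right; split.
  by move=> _ _; apply: bwd => //; left.
case: (boolP ([set v; x2] \in B)) fwd => b2 fwd; last by move=> _ _ _; apply: fwd => //; left.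
move=> bwd /= b1 _; case: (boolP ([set u; y2] \in B)) bwd => a2 bwd.
  by apply: fwd => //; right; split.
by apply: bwd => //; left.
Qed.

(** The edge-based generation never gets stuck: the exchange gives up only edges outside [B], so the
    new tour contains [B] and [e]. *)
Lemma admissible_extends H B e : is_ham n H -> B \subset H -> admissible n B e ->
  exists2 H', is_ham n H' & e |: B \subset H'.
Proof.
move=> hH BH adm; have [eH|eH] := boolP (e \in H).
  by exists H => //; rewrite subUset sub1set eH.
have /and4P[/cards2P[u [v [_ Ee]]] _ _ _] := adm.
rewrite Ee in eH adm *.
have [a [b [g [a' [b' [r [[aB bB gB] _ _ [ur sr lr Kr]]]]]]]] := exchange hH BH eH adm.
exists (cycle_edges v r); first exact: is_ham_cycle_edges (is_ham_gt2 hH) ur sr.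
rewrite /cycle_edges lr; apply: setUS; apply: subset_trans Kr.
apply/subsetP => d dB; rewrite !inE (subsetP BH _ dB) andbT !negb_or.
have neB (S : {set 'I_n}) : S \in H :\: B -> d != S.
  by rewrite inE => /andP[+ _]; apply: contraNneq => <-.
by rewrite !neB.
Qed.

End HamiltonianCycles.

(** * Levels *)

Section Level.
Variables (R : realType) (n : nat).
Hypothesis n_gt2 : (2 < n)%N.
Implicit Types (H B : {set {set 'I_n}}) (e : {set 'I_n}).

Definition sstar : {set {set 'I_n}} := cyc_edges n n id.

Definition level H := #|H :\: sstar|.

Lemma is_ham_sstar : is_ham n sstar.
Proof. by split=> //; exists 1%g; apply: eq_imset => i; rewrite !perm1. Qed.

Lemma dG1E e : dG1 R n e = if e \in sstar then 1 else n%:R.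
Proof.
rewrite /dG1; congr (if _ then _ else _); apply/existsP/imsetP => [[i /existsP[j]]|[i _ ->]].
  by move=> /andP[/eqP -> /eqP ij]; exists i => //; congr [set _; _]; apply: val_inj.
by exists i; apply/existsP; exists (ordS i); rewrite !eqxx.
Qed.

Lemma level_le H : is_ham n H -> (level H <= n)%N.
Proof. by move=> hH; apply: leq_trans (subset_leq_card (subsetDl _ _)) _; rewrite is_ham_card. Qed.

Lemma cost_level H : is_ham n H -> cost R n H = n%:R + (n%:R - 1) * (level H)%:R.
Proof.
move=> hH; rewrite /cost (big_setID sstar) /=.
rewrite (eq_bigr (fun=> 1)); last by move=> e; rewrite dG1E inE => /andP[_ ->].
rewrite [X in _ + X](eq_bigr (fun=> n%:R)); last first.
  by move=> e; rewrite dG1E inE => /andP[/negbTE ->].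
rewrite !sumr_const -/(level H) -[n%:R *+ _]mulr_natr.
have : (#|H :&: sstar| + level H = n)%N by rewrite /level cardsID is_ham_card.
move/(congr1 (fun k => k%:R : R)); rewrite natrD => <-; ring.
Qed.

Lemma cost_le_level H H' : is_ham n H -> is_ham n H' ->
  cost R n H <= cost R n H' -> (level H <= level H')%N.
Proof.
move=> hH hH'; rewrite !cost_level // lerD2l ler_pM2l ?ler_nat //.
by rewrite subr_gt0 ltr1n; lia.
Qed.

Lemma optimal_level0 H : is_ham n H -> level H = 0%N -> optimal R n H.
Proof.
move=> hH l0; split=> // H' hH'; rewrite !cost_level // l0 mulr0 addr0 lerDl.
by rewrite mulr_ge0 // subr_ge0 ler1n; lia.
Qed.

(** All tours have [n] edges, so the level falls exactly when the number of optimal edges rises. *)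
Lemma level_lt H H' e : is_ham n H -> is_ham n H' -> e \in sstar :\: H ->
  e |: (H :&: sstar) \subset H' -> (level H' < level H)%N.
Proof.
move=> hH hH' eD sub.
have := cardsID sstar H; have := cardsID sstar H'.
rewrite (is_ham_card hH) (is_ham_card hH') -!/(level _) => E' E.
have : (#|H :&: sstar| < #|H' :&: sstar|)%N; last by lia.
move: eD; rewrite in_setD => /andP[eH es].
apply: leq_trans (_ : #|e |: (H :&: sstar)| <= _)%N; first by rewrite cardsU1 inE (negbTE eH).
by apply/subset_leq_card; rewrite subsetI sub subUset sub1set es subsetIr.
Qed.

Lemma card_sstar_diff H : is_ham n H -> #|sstar :\: H| = level H.
Proof.
move=> hH; have := cardsID sstar H; have := cardsID H sstar.
by rewrite (is_ham_card hH) (is_ham_card is_ham_sstar) setIC -/(level H); lia.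
Qed.

(** The choice [B = H :&: sstar] protects the optimal edges already present; [{u, v}] is admissible
    for it because both lie in the optimal tour. *)
Lemma exchange_sstar H u v : is_ham n H -> [set u; v] \in sstar :\: H ->
  exists a b g a' b' r, exchange_spec H (H :&: sstar) u v a b g a' b' r.
Proof.
rewrite in_setD => hH /andP[eH es]; apply: exchange => //; first exact: subsetIl.
apply: (admissible_sub_ham is_ham_sstar); last by rewrite inE (negbTE eH).
by rewrite subUset sub1set es subsetIr.
Qed.

End Level.

(** * Edge-based generation *)

Section EdgeGeneration.
Variables (R : realType) (n : nat) (P : pmat R n).
Implicit Types (B H : {set {set 'I_n}}) (e : {set 'I_n}) (t : pred {set {set 'I_n}}).

Definition total_weight B := \sum_(f | admissible n B f) eweight R n P f.

(* The probability that [m] further steps of the edge-based generation lead from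
   the edge set [B] to an edge set satisfying [t]. *)
Fixpoint completion_prob t m B : R :=
  if m is m'.+1 then
    \sum_(e | admissible n B e) eweight R n P e / total_weight B * completion_prob t m' (e |: B)
  else (t B)%:R.

Let cut m (s : {ffun 'I_m -> {set 'I_n}}) k : {set {set 'I_n}} := [set s i | i : 'I_m & (i < k)%N].
Let step B e := if admissible n B e then eweight R n P e / total_weight B else 0.

Lemma completion_prob_ffun t m B :
  \sum_(s : {ffun 'I_m -> {set 'I_n}})
     (\prod_(k < m) step (B :|: cut s k) (s k)) * (t (B :|: cut s m))%:R =
  completion_prob t m B.
Proof.
elim: m B => [|m IH] B.
  rewrite (big_pred1 [ffun i : 'I_0 => set0]) /=; last first.
    by move=> s; apply/esym/eqP/ffunP => -[].
  rewrite big_ord0 mul1r; congr (t _)%:R.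
  by rewrite -[RHS]setU0; congr (_ :|: _); apply/setP => e; rewrite inE; apply/imsetP => -[[]].
pose glue (p : {set 'I_n} * {ffun 'I_m -> {set 'I_n}}) : {ffun 'I_m.+1 -> {set 'I_n}} :=
  [ffun i => if unlift ord0 i is Some j then p.2 j else p.1].
pose unglue (s : {ffun 'I_m.+1 -> {set 'I_n}}) := (s ord0, [ffun j => s (lift ord0 j)]).
have glueK : cancel glue unglue.
  case=> a s; rewrite /unglue /glue ffunE unlift_none; congr (_, _).
  by apply/ffunP => j; rewrite !ffunE liftK.
have unglueK : cancel unglue glue.
  move=> s; apply/ffunP => i; rewrite ffunE; case: unliftP => [j|] -> //=.
  by rewrite ffunE.
rewrite (reindex glue) /=; last by exists unglue => p _; [exact: glueK | exact: unglueK].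
have g0 a s : glue (a, s) ord0 = a by rewrite ffunE unlift_none.
have gS a s j : glue (a, s) (lift ord0 j) = s j by rewrite ffunE liftK.
have cut0 (s : {ffun 'I_m.+1 -> {set 'I_n}}) : cut s 0 = set0.
  by apply/setP => e; rewrite inE; apply/imsetP => -[i]; rewrite inE.
have cutS a s k : B :|: cut (glue (a, s)) k.+1 = (a |: B) :|: cut s k.
  rewrite setUAC [in RHS]setUC; congr (_ :|: _).
  apply/setP => e; rewrite in_setU1; apply/imsetP/orP => [[i + ->]|[/eqP ->|/imsetP[i + ->]]].
  - rewrite inE; case: (unliftP ord0 i) => [j|] ->; last by rewrite g0 eqxx; left.
    by rewrite gS => jk; right; apply/imsetP; exists j; rewrite // inE; move: jk; rewrite lift0.
  - by exists ord0; rewrite ?inE ?g0.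
  - by rewrite inE => ik; exists (lift ord0 i); rewrite ?gS // inE lift0.
transitivity (\sum_a step B a * completion_prob t m (a |: B)).
  rewrite (eq_bigr (fun p => step B p.1 * ((\prod_(k < m) step (p.1 |: B :|: cut p.2 k) (p.2 k)) *
     (t (p.1 |: B :|: cut p.2 m))%:R))); last first.
    case=> a s _ /=; rewrite big_ord_recl /= cut0 setU0 g0 mulrA cutS; congr (_ * _ * _).
    by apply: eq_bigr => k _; rewrite gS -cutS.
  rewrite -(pair_bigA _ (fun a s => step B a * ((\prod_(k < m) step (a |: B :|: cut s k) (s k)) *
     (t (a |: B :|: cut s m))%:R))) /=.
  by apply: eq_bigr => a _; rewrite -big_distrr /= IH.
rewrite /= [RHS]big_mkcond /=; apply: eq_bigr => a _; rewrite /step.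
by case: ifP; rewrite ?mul0r.
Qed.

Lemma sum_egen t : \sum_(H | t H) egen R n P H = completion_prob t n set0.
Proof.
rewrite -completion_prob_ffun /egen (exchange_big_dep predT) //=.
apply: eq_bigr => s _; rewrite set0U -/(Defs.prefix n s n).
transitivity (\sum_(H | H == Defs.prefix n s n) eprob R n P s * (t H)%:R).
  rewrite [LHS]big_mkcond [RHS]big_mkcond; apply: eq_bigr => H _.
  by rewrite eq_sym andbC; case: eqP; case: (t H); rewrite /= ?mulr1 ?mulr0.
rewrite big_pred1_eq; congr (_ * _); apply: eq_bigr => k _.
by rewrite set0U.
Qed.

Lemma eweight_pair u v : u != v -> eweight R n P [set u; v] = P u v + P v u.
Proof.
move=> uv; rewrite /eweight (bigD1 u) //=. rewrite [X in _ + X](bigD1 v) /=; last by rewrite eq_sym.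
have pairE i j : ([set u; v] == [set i; j]) = ((i == u) && (j == v)) || ((i == v) && (j == u)).
  apply/eqP/orP => [E|[/andP[/eqP -> /eqP ->]|/andP[/eqP -> /eqP ->]]] //; last by rewrite setUC.
  have := congr1 (fun S : {set _} => i \in S) E; rewrite !inE eqxx /= => hi.
  have := congr1 (fun S : {set _} => j \in S) E; rewrite !inE eqxx orbT /= => hj.
  have := congr1 (fun S : {set _} => u \in S) E; rewrite !inE eqxx /= => hu.
  have := congr1 (fun S : {set _} => v \in S) E; rewrite !inE eqxx orbT /= => hv.
  case/orP: hi => /eqP hi; rewrite hi eqxx /=; [left|right].
    by move: hv; rewrite hi [v == u]eq_sym (negbTE uv) => /esym; rewrite eq_sym.
  by move: hu; rewrite hi (negbTE uv) => /esym; rewrite eq_sym.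
rewrite (big_pred1 v) => [|j]; last first.
  rewrite pairE eqxx /= [u == v](negbTE uv) orbF.
  by case: (j =P v) => [->|]; rewrite ?uv ?andbF.
rewrite (big_pred1 u) => [|j]; last first.
  rewrite pairE eqxx /= [v == u]eq_sym (negbTE uv) /=.
  by case: (j =P u) => [->|]; rewrite ?[v == u]eq_sym ?uv ?andbF.
rewrite big1 ?addr0 // => i /andP[iu iv]; rewrite big_pred0 // => j.
by rewrite pairE (negbTE iu) (negbTE iv) andbF.
Qed.

Hypothesis P_gt0 : forall i j, i != j -> 0 < P i j.

Lemma eweight_gt0 e : #|e| = 2 -> 0 < eweight R n P e.
Proof.
by move/eqP/cards2P => [u [v [uv ->]]]; rewrite eweight_pair // addr_gt0 ?P_gt0 // eq_sym.
Qed.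

Lemma admissible_card2 B e : admissible n B e -> #|e| = 2.
Proof. by case/and4P => /eqP. Qed.

Lemma eweight_ge0 B e : admissible n B e -> 0 <= eweight R n P e.
Proof. by move=> /admissible_card2/eweight_gt0/ltW. Qed.

Lemma total_weight_ge0 B : 0 <= total_weight B.
Proof. by apply: sumr_ge0 => e; exact: eweight_ge0. Qed.

Lemma completion_prob_ge0 t m B : 0 <= completion_prob t m B.
Proof.
elim: m B => [|m IH] B /=; first exact: ler0n.
apply: sumr_ge0 => e adm; rewrite mulr_ge0 // divr_ge0 ?total_weight_ge0 //.
exact: eweight_ge0 adm.
Qed.

(** By [admissible_extends] the edge set stays inside some tour whatever is drawn. Hence an
    admissible edge always exists, the step probabilities sum to 1, and the result is a tour
    containing [B]. *)
Lemma completion_prob1 t m B H : is_ham n H -> B \subset H -> (#|B| + m)%N = n ->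
  (forall H', is_ham n H' -> B \subset H' -> t H') -> completion_prob t m B = 1.
Proof.
elim: m B H => [|m IH] B H hH BH cB tP /=.
  rewrite addn0 in cB; suff -> : B = H by rewrite tP.
  by apply/eqP; rewrite eqEcard BH cB (is_ham_card hH) leqnn.
have [e /setDP[eH eB]] : exists e, e \in H :\: B.
  by apply/set0Pn; rewrite -card_gt0 cardsD (setIidPr BH) subn_gt0 (is_ham_card hH)
    -[X in (_ < X)%N]cB addnS ltnS leq_addr.
have adm : admissible n B e by apply: (admissible_sub_ham hH) eB; rewrite subUset sub1set eH.
rewrite (eq_bigr (fun e => eweight R n P e / total_weight B)) => [|f admf].
  rewrite -big_distrl /= divff // gt_eqF // (bigD1 e) //=.
  rewrite ltr_pwDl ?eweight_gt0 ?(admissible_card2 adm) //.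
  by apply: sumr_ge0 => f /andP[/eweight_ge0].
have [H' hH' sub] := admissible_extends hH BH admf.
rewrite (IH _ H') ?mulr1 //.
  by case/and4P: admf => _ fB _ _; rewrite cardsU1 fB addSnnS.
by move=> H'' h'' s''; apply: tP => //; apply: subset_trans s''; exact: subsetUr.
Qed.

End EdgeGeneration.

Lemma disjoint_setU1r (T : finType) (A B : {set T}) x :
  [disjoint A & x |: B] = (x \notin A) && [disjoint A & B].
Proof.
by rewrite disjoint_sym disjoints_subset subUset sub1set in_setC -disjoints_subset disjoint_sym.
Qed.

(** * Counting admissible edges *)

Section AdmissibleEdges.
Local Open Scope nat_scope.
Variable n : nat.
Implicit Types (H B : {set {set 'I_n}}) (e : {set 'I_n}).

(** Handshake count: both sides count the pairs of an edge of [B] and a vertex on it. *)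
Lemma sum_deg B : {in B, forall e, #|e| = 2} -> \sum_(v < n) deg n B v = 2 * #|B|.
Proof.
move=> B2; rewrite -sum1_card big_distrr /=.
rewrite (eq_bigr (fun v => \sum_(e in B) (v \in e))) => [|v _]; last first.
  rewrite /deg -sum1_card (eq_bigl (fun e => (e \in B) && (v \in e))) => [|e]; last by rewrite inE.
  by rewrite big_mkcondr; apply: eq_bigr => e _; case: (v \in e).
rewrite exchange_big /=; apply: eq_bigr => e eB; rewrite muln1 -(B2 _ eB) -sum1_card.
by rewrite [RHS]big_mkcond; apply: eq_bigr => v _; case: (v \in e).
Qed.

(** The degrees fall short of 2 by [2 * m] in total, and each vertex counted here lacks at least
    one. *)
Lemma card_deg_le1 H B m : is_ham n H -> B \subset H -> #|B| + m = n ->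
  #|[set v | deg n B v <= 1]| <= 2 * m.
Proof.
move=> hH BH cB.
have B2 : {in B, forall e, #|e| = 2} by move=> e eB; apply: (is_ham_edge2 hH); exact: (subsetP BH).
have dle v : deg n B v <= 2.
  apply: leq_trans (is_ham_deg v hH); apply: subset_leq_card; apply/subsetP => e.
  by rewrite !inE => /andP[/(subsetP BH) -> ->].
have : \sum_(v < n) (2 - deg n B v) + 2 * #|B| = 2 * n.
  rewrite -(sum_deg B2) -big_split /= (eq_bigr (fun=> 2)) => [|v _]; last by rewrite subnK.
  by rewrite sum_nat_const card_ord mulnC.
have : #|[set v | deg n B v <= 1]| <= \sum_(v < n) (2 - deg n B v).
  rewrite -sum1_card [X in X <= _]big_mkcond; apply: leq_sum => v _.
  by rewrite inE; case: ifP => // d1; rewrite subn_gt0 ltnS.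
move=> le1 eq1; move: cB le1 eq1; clear; lia.
Qed.

Lemma admissible_deg_le1 B e v : admissible n B e -> v \in e -> deg n B v <= 1.
Proof.
case/and4P => _ eB /forallP/(_ v) + _ ve.
suff -> : deg n (e |: B) v = (deg n B v).+1 by [].
rewrite /deg (_ : [set x in e |: B | v \in x] = e |: [set x in B | v \in x]).
  by rewrite cardsU1 inE (negbTE eB).
by apply/setP => x; rewrite !inE; case: (x =P e) => [->|]; rewrite ?ve.
Qed.

(** An admissible edge joins two vertices of degree at most 1, and there are at most [2 * m] of
    these. *)
Lemma card_admissible_le H B m : is_ham n H -> B \subset H -> #|B| + m = n ->
  #|[set e | admissible n B e]| <= 2 * m ^ 2.
Proof.
move=> hH BH cB; have le2 := card_deg_le1 hH BH cB.
set A := [set v | deg n B v <= 1] in le2.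
apply: leq_trans (_ : #|[set e : {set 'I_n} | e \subset A & #|e| == 2]| <= _).
  apply: subset_leq_card; apply/subsetP => e; rewrite !inE => adm.
  rewrite (admissible_card2 adm) eqxx andbT; apply/subsetP => v ve.
  by rewrite inE (admissible_deg_le1 adm).
rewrite cards_draws; apply: leq_trans (leq_bin2l 2 le2) _.
rewrite bin2; apply: leq_trans (half_leq (_ : _ <= 2 * m * (2 * m))) _.
  by rewrite leq_mul // leq_pred.
by rewrite -mulnA mul2n doubleK mulnCA mulnn.
Qed.

End AdmissibleEdges.

(** This inequality sets the threshold 12 for [n]: it amounts to [x ^ 2 - 12 x + 8 >= 0], which
    fails at 11. *)
Lemma weight_excess_le (R : realFieldType) (x : R) :
  12 <= x -> 6 * x / ((x - 1) * (x - 2)) <= 8 / x.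
Proof.
move=> x12; rewrite ler_pdivrMr; last by rewrite mulr_gt0; lra.
rewrite mulrAC ler_pdivlMr; last by lra.
nra.
Qed.

Lemma inv_sqr_le (R : realFieldType) (x : R) :
  12 <= x -> (x ^+ 2)^-1 <= ((x - 1) * (x - 2))^-1.
Proof.
move=> x12; rewrite lef_pV2 ?posrE ?exprn_gt0 ?mulr_gt0; lra.
Qed.

(** Arithmetic of the induction step in [after_exchange_ge]: [x] edges of [K] are still missing, [y]
    of them among [a'] and [b']. *)
Lemma exchange_ratio_ge (R : realFieldType) (x y : R) : 0 < x -> 0 <= y ->
  (x + 1)^-1 <= (x + 1 + y)^-1 * x^-1 * (x + y).
Proof.
move=> x0 y0; rewrite -invfM mulrC ler_pdivlMr ?mulr_gt0 //; try lra.
by rewrite mulrC ler_pdivrMr; nra.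
Qed.

Lemma quarter_le_half_exp (R : realFieldType) (x y : bool) : 4^-1 <= 2^-1 ^+ (x + y) :> R.
Proof. by case: x; case: y; rewrite /= ?addn0 ?add0n ?expr0 ?expr1 ?expr2; lra. Qed.

(** * Lower bounds for the edge-based generation *)

Section EdgeBounds.
Variables (R : realType) (n : nat) (H : {set {set 'I_n}}).
Hypothesis n_ge12 : (12 <= n)%N.
Hypothesis hH : is_ham n H.
Implicit Types (B : {set {set 'I_n}}) (e : {set 'I_n}).

Let P := PiH R n H.
Let c := pi_max R n.
Let d := pi_min R n.
(** The factor lost per step against an ideal step that draws uniformly from [h] edges of [H]. *)
Let gam : R := (1 + 8 / n%:R)^-1.

Let nR : (12 : R) <= n%:R. Proof. by rewrite ler_nat. Qed.

Lemma pi_max_gt0 : 0 < pi_max R n.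
Proof. by rewrite /pi_max; have := nR; move: (n%:R : R) => x x12; rewrite subr_gt0 ltr_pdivrMr; lra. Qed.

Lemma pi_minE : pi_min R n = pi_max R n / ((n%:R - 1) * (n%:R - 2)).
Proof.
rewrite /pi_min /pi_max; have := nR; move: (n%:R : R) => x x12; field.
by apply/and3P; split; apply/eqP; lra.
Qed.

Lemma pi_min_gt0 : 0 < pi_min R n.
Proof.
rewrite pi_minE divr_gt0 ?pi_max_gt0 //; have := nR; move: (n%:R : R) => x x12.
by rewrite mulr_gt0 //; lra.
Qed.

Lemma PiH_gt0 i j : i != j -> 0 < P i j.
Proof. by move=> ij; rewrite /P /PiH (negbTE ij); case: ifP; rewrite ?pi_max_gt0 ?pi_min_gt0. Qed.

Lemma eweight_PiH e : #|e| = 2 -> eweight R n P e = 2 * (if e \in H then c else d).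
Proof.
move/eqP/cards2P => [u [v [uv ->]]]; rewrite eweight_pair // /P /PiH.
by rewrite [v == u]eq_sym (negbTE uv) [[set v; u]]setUC mulr_natl mulr2n.
Qed.

Lemma gam_gt0 : 0 < gam.
Proof. by rewrite invr_gt0; have := nR; move: (n%:R : R) => x x12; rewrite addr_gt0 // divr_gt0; lra. Qed.

Lemma gam_le1 : gam <= 1.
Proof. by rewrite invf_le1 ?lerDl ?divr_ge0 // -invr_gt0 gam_gt0. Qed.

(** With [m <= 3 * h] and [m <= n] there are at most [2 m ^ 2 <= 6 n h] admissible edges outside
    [H], each lighter by the factor [(n - 1) (n - 2)]; they add at most a share [8 / n]. The tour
    [H'] differs from [H] because after an exchange [B] is no longer inside [H]. *)
Lemma total_weight_le H' B m h : is_ham n H' -> B \subset H' -> (#|B| + m)%N = n ->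
  (0 < h)%N -> (m <= 3 * h)%N -> (#|[set e in H | admissible n B e]| <= h)%N ->
  total_weight P B <= 2 * c * h%:R / gam.
Proof.
move=> hH' BH cB h0 mh hh.
have c0 : 0 <= 2 * c by rewrite mulr_ge0 // ltW // pi_max_gt0.
have d0 : 0 <= 2 * d by rewrite mulr_ge0 // ltW // pi_min_gt0.
apply: (@le_trans _ _ (2 * c * h%:R + 2 * d * (2 * m ^ 2)%N%:R)).
  rewrite /total_weight (bigID (mem H)) /=; apply: lerD.
    rewrite (eq_bigr (fun=> 2 * c)) => [|e /andP[adm eH]]; last first.
      by rewrite eweight_PiH ?eH // (admissible_card2 adm).
    rewrite sumr_const -[X in X <= _]mulr_natr ler_wpM2l // ler_nat.
    apply: leq_trans hh; rewrite cardE -cardE; apply: subset_leq_card.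
    by apply/subsetP => e; rewrite !inE andbC.
  rewrite (eq_bigr (fun=> 2 * d)) => [|e /andP[adm /negbTE eH]]; last first.
    by rewrite eweight_PiH ?eH // (admissible_card2 adm).
  rewrite sumr_const -[X in X <= _]mulr_natr ler_wpM2l // ler_nat.
  apply: leq_trans (card_admissible_le hH' BH cB); apply: subset_leq_card.
  by apply/subsetP => e; rewrite !inE => /andP[].
have m_le : (2 * m ^ 2)%N%:R <= 6 * n%:R * h%:R :> R.
  rewrite -!natrM ler_nat; have : (m <= n)%N by rewrite -[X in (_ <= X)%N]cB leq_addl.
  by clear -mh; nia.
have gE (x : R) : x / gam = x + x * (8 / n%:R) by rewrite /gam invrK mulrDr mulr1.
rewrite gE lerD2l (_ : d = c / ((n%:R - 1) * (n%:R - 2))); last exact: pi_minE.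
have c0' : 0 < c := pi_max_gt0.
apply: (@le_trans _ _ (2 * (c / ((n%:R - 1) * (n%:R - 2))) * (6 * n%:R * h%:R))).
  rewrite ler_wpM2l // mulr_ge0 // divr_ge0 ?(ltW c0') //.
  by rewrite mulr_ge0 // subr_ge0; have := nR; lra.
have -> : 2 * (c / ((n%:R - 1) * (n%:R - 2))) * (6 * n%:R * h%:R) =
  2 * c * h%:R * (6 * n%:R / ((n%:R - 1) * (n%:R - 2))).
  by rewrite !mulrA; ring.
rewrite ler_wpM2l ?mulr_ge0 // ?(ltW c0') //.
exact: weight_excess_le nR.
Qed.

Lemma step_ge H' B m h e : is_ham n H' -> B \subset H' -> (#|B| + m)%N = n ->
  (0 < h)%N -> (m <= 3 * h)%N -> (#|[set e in H | admissible n B e]| <= h)%N ->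
  admissible n B e ->
  gam / h%:R * (if e \in H then 1 else (n%:R ^+ 2)^-1) <= eweight R n P e / total_weight P B.
Proof.
move=> hH' BH cB h0 mh hh adm.
have c0 := pi_max_gt0; rewrite -/c in c0.
have wl := total_weight_le hH' BH cB h0 mh hh.
have w0 : 0 < total_weight P B.
  rewrite /total_weight (bigD1 e) //= ltr_pwDl ?(eweight_gt0 PiH_gt0) ?(admissible_card2 adm) //.
  by apply: sumr_ge0 => f /andP[/(eweight_ge0 PiH_gt0)].
have hR : 0 < h%:R :> R by rewrite ltr0n.
rewrite ler_pdivlMr //.
set k := (X in gam / _ * X); have k0 : 0 <= k.
  by rewrite /k; case: ifP; rewrite // invr_ge0 exprn_ge0.
apply: (@le_trans _ _ (gam / h%:R * k * (2 * c * h%:R / gam))).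
  by rewrite ler_wpM2l // mulr_ge0 // divr_ge0 ?(ltW gam_gt0) ?ler0n.
have -> : gam / h%:R * k * (2 * c * h%:R / gam) = 2 * (c * k).
  by field; rewrite ?lt0r_neq0 ?gam_gt0.
rewrite eweight_PiH ?(admissible_card2 adm) // ler_wpM2l //.
rewrite /k; case: ifP => _; first by rewrite mulr1.
rewrite (_ : d = c / ((n%:R - 1) * (n%:R - 2))); last exact: pi_minE.
rewrite ler_wpM2l ?(ltW c0) //.
exact: inv_sqr_le nR.
Qed.

Lemma completion_prob_ge (S : {set {set 'I_n}}) t m B (f : {set 'I_n} -> R) :
  {in S, forall e, admissible n B e} ->
  {in S, forall e, f e <= eweight R n P e / total_weight P B * completion_prob P t m (e |: B)} ->
  \sum_(e in S) f e <= completion_prob P t m.+1 B.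
Proof.
move=> Sadm Sf; rewrite /= [X in _ <= X](bigID (mem S)) /= -[X in X <= _]addr0; apply: lerD.
  rewrite [X in _ <= X](eq_bigl (mem S)) => [|e]; first exact: ler_sum.
  by rewrite /= andbC; case: (boolP (e \in S)) => // /Sadm ->.
apply: sumr_ge0 => e /andP[adm _]; rewrite mulr_ge0 ?(completion_prob_ge0 PiH_gt0) //.
by rewrite divr_ge0 ?(total_weight_ge0 PiH_gt0) ?(eweight_ge0 PiH_gt0 adm).
Qed.

Lemma admissible_in_ham B e : B \subset H -> e \in H :\: B -> admissible n B e.
Proof.
by move=> BH /setDP[eH eB]; apply: (admissible_sub_ham hH) eB; rewrite subUset sub1set eH.
Qed.

Lemma sub_ham_cardD B m : B \subset H -> (#|B| + m)%N = n -> #|H :\: B| = m.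
Proof.
move=> BH cB; rewrite cardsD (setIidPr BH) (is_ham_card hH).
by rewrite -[X in (X - _)%N = _]cB addKn.
Qed.

Lemma admissible_ham_le B m : B \subset H -> (#|B| + m)%N = n ->
  (#|[set e in H | admissible n B e]| <= m)%N.
Proof.
move=> BH cB; rewrite -(sub_ham_cardD BH cB); apply: subset_leq_card.
by apply/subsetP => e; rewrite !inE => /andP[-> /and4P[_ ->]].
Qed.

Lemma card_addU1 B m e : e \notin B -> (#|B| + m.+1)%N = n -> (#|e |: B| + m)%N = n.
Proof. by move=> eB; rewrite cardsU1 eB addSnnS. Qed.

(** All missing edges of [H] are admissible and each is drawn with probability at least [gam]
    divided by their number, so a step stays inside [H] with probability at least [gam]. *)
Lemma reproduce_ge m B : B \subset H -> (#|B| + m)%N = n ->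
  gam ^+ m <= completion_prob P (pred1 H) m B.
Proof.
elim: m B => [|m IH] B BH cB.
  rewrite expr0 /= (_ : B = H) ?eqxx //.
  by apply/eqP; rewrite eqEcard BH (is_ham_card hH) -[X in (X <= _)%N]cB addn0 /=.
apply: le_trans (completion_prob_ge (S := H :\: B) (f := fun=> gam / m.+1%:R * gam ^+ m) _ _).
- rewrite sumr_const (sub_ham_cardD BH cB) -[X in _ <= X]mulr_natr exprS.
  by rewrite [X in _ <= X](_ : _ = gam * gam ^+ m) //; field; rewrite addrC natr1 pnatr_eq0.
- by move=> e; exact: admissible_in_ham.
- move=> e eD; have adm := admissible_in_ham BH eD; have /setDP[eH eB] := eD.
  rewrite ler_pM ?divr_ge0 ?exprn_ge0 ?(ltW gam_gt0) //.
    have := step_ge hH BH cB (ltn0Sn m) _ (admissible_ham_le BH cB) adm.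
    by rewrite eH mulr1; apply; rewrite leq_pmull.
  by apply: IH; [rewrite subUset sub1set eH | exact: card_addU1].
Qed.

(** Drawing [a'] or [b'] doubles the potential [2^-1 ^+ q], as one competitor, [a] or [b], drops
    out. *)
Lemma half_pow_ge (a' b' f : {set 'I_n}) B : a' != b' -> f \notin B ->
  let q B := ((a' \notin B) + (b' \notin B))%N in
  2^-1 ^+ q B * (1 + (f == a')%:R + (f == b')%:R) <= 2^-1 ^+ q (f |: B) :> R.
Proof.
move=> ab fB /=; rewrite !in_setU1 ![_ == f]eq_sym !negb_or.
case: (f =P a') => [fa|_].
  rewrite -fa fB (_ : (f == b') = false); last by rewrite fa (negbTE ab).
  by rewrite /= addr0 exprD expr1; case: (b' \notin B); rewrite ?expr1 ?expr0; lra.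
case: (f =P b') => [fb|_].
  by rewrite -fb fB /= addr0 exprD expr1; case: (a' \notin B); rewrite ?expr1 ?expr0; lra.
by rewrite !addr0 mulr1.
Qed.

(* Once [e] is chosen, [H] is left for a better tour if the remaining edges of [K] come
   before [a], [b], [g]. Since [u] has degree 2 as soon as [e] and [a'] are present, [a]
   only competes with [a'] (a factor 1/2), likewise [b] with [b'], while [g] has to come
   last among itself and the remaining edges of [K] (the denominator). *)
Lemma after_exchange_ge (t : pred {set {set 'I_n}}) B0 u v a b g a' b' r m B :
  let K := H :\: [set a; b; g] in let e := [set u; v] in
  exchange_spec H B0 u v a b g a' b' r -> e \notin H ->
  (forall H', is_ham n H' -> e |: K \subset H' -> t H') ->
  e \in B -> B \subset e |: K -> (#|B| + m)%N = n ->
  gam ^+ m * 2^-1 ^+ ((a' \notin B) + (b' \notin B)) / #|K :\: B|.+1%:R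
    <= completion_prob P t m B.
Proof.
move=> K e [[aH bH gH] [ua ua' vb vb'] [a'K b'K ab'] [ur sr lr Kr]] eH tP.
pose Hs := cycle_edges v r.
have hHs : is_ham n Hs := is_ham_cycle_edges (is_ham_gt2 hH) ur sr.
have eKs : e |: K \subset Hs by rewrite /Hs /cycle_edges lr; apply: setUS.
have KH : K \subset H by exact: subsetDl.
have eK : e \notin K by apply: contra eH; exact: (subsetP KH).
have half_le1 k : 2^-1 ^+ k <= 1 :> R by rewrite exprn_ile1 // invf_le1 // ler1n.
(* Once all of [K] is drawn, every possible completion satisfies [t]. *)
have base k B' : e \in B' -> B' \subset e |: K -> (#|B'| + k)%N = n -> #|K :\: B'| = 0%N ->
    gam ^+ k * 2^-1 ^+ ((a' \notin B') + (b' \notin B')) / #|K :\: B'|.+1%:R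
      <= completion_prob P t k B'.
  move=> eB Bsub cB r0; rewrite r0 divr1.
  rewrite (completion_prob1 PiH_gt0 hHs (subset_trans Bsub eKs) cB).
    by rewrite mulr_ile1 ?exprn_ge0 ?(ltW gam_gt0) ?invr_ge0 // exprn_ile1 ?(ltW gam_gt0) ?gam_le1.
  move=> H' hH' BH'; apply: tP => //; apply: subset_trans BH'.
  by rewrite subUset sub1set eB -setD_eq0 -cards_eq0 r0.
elim: m B => [|m IH] B eB Bsub cB; have BHs := subset_trans Bsub eKs.
  apply: base => //; suff -> : B = Hs.
    by apply/eqP; rewrite cards_eq0 setD_eq0 (subset_trans (subsetUr _ _) eKs).
  by apply/eqP; rewrite eqEcard BHs (is_ham_card hHs) -[X in (X <= _)%N]cB addn0 /=.
have [r0|rpos] := posnP #|K :\: B|; first exact: base.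
set q := ((a' \notin B) + (b' \notin B))%N; set rr := #|K :\: B| in rpos *.
(* Edges of [H] that can still be drawn: [rr] from [K], possibly [g], and [a] or [b] only as long as
   [a'] or [b'] is missing. *)
pose h := (rr + 1 + q)%N.
have Kadm : {in K :\: B, forall f, admissible n B f}.
  move=> f /setDP[fK fB]; apply: (admissible_sub_ham hHs) fB.
  by rewrite subUset BHs sub1set (subsetP eKs) // in_setU1 fK orbT.
have hh : (#|[set f in H | admissible n B f]| <= h)%N.
  have card_if (x : {set 'I_n}) c0 : (#|[set y | (y == x) && c0]| <= c0)%N.
    case: c0; last by rewrite (eq_card0 (A := [set _ | _])) // => y; rewrite inE andbF.
    apply: leq_trans (_ : #|[set x]| <= _)%N; last by rewrite cards1.
    by apply: subset_leq_card; apply/subsetP => y; rewrite !inE andbT.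
  have neH x : x \in H -> e != x by apply: contraTneq => <-.
  pose X := (K :\: B) :|: [set g] :|: ([set y | (y == a) && (a' \notin B)] :|:
     [set y | (y == b) && (b' \notin B)]).
  apply: leq_trans (_ : #|X| <= _)%N; last first.
    rewrite /X /h /q; apply: leq_trans (leq_card_setU _ _) _; apply: leq_add.
      by apply: leq_trans (leq_card_setU _ _) _; rewrite cards1.
    by apply: leq_trans (leq_card_setU _ _) _; apply: leq_add; exact: card_if.
  apply: subset_leq_card; apply/subsetP => f; rewrite inE => /andP[fH adm].
  have fB : f \notin B by case/and4P: adm.
  have [fK|] := boolP (f \in K); first by rewrite /X !in_setU in_setD fK fB.
  rewrite in_setD fH andbT negbK !in_setU !in_set1 -orbA => /or3P[/eqP fE|/eqP fE|/eqP fE].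
  - rewrite /X ?in_setU !inE fE eqxx /=; apply/orP; right; apply/orP; left; apply/negP => a'B.
    apply: (admissible_deg adm (w := u) _ (neH a' (subsetP KH _ a'K))) => //.
      by rewrite fE.
    by rewrite set21.
  - rewrite /X ?in_setU !inE fE eqxx /=; apply/orP; right; apply/orP; right; apply/negP => b'B.
    apply: (admissible_deg adm (w := v) _ (neH b' (subsetP KH _ b'K))) => //.
      by rewrite fE.
    by rewrite set22.
  - by rewrite /X ?in_setU !inE fE eqxx /= !orbT.
have card_B : (#|B| + rr = 1 + #|K|)%N.
  rewrite -[(1 + _)%N](_ : #|e |: K| = _); last by rewrite cardsU1 eK.
  rewrite -(cardsID B (e |: K)) (setIidPr Bsub); congr (_ + _)%N.
  apply: eq_card => f; rewrite !inE; case: (f =P e) => [->|] //.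
  by rewrite eB.
have card_K : (n <= #|K| + 3)%N.
  rewrite -[X in (X <= _)%N](is_ham_card hH) -(cardsID [set a; b; g] H) -/K addnC leq_add2l.
  apply: leq_trans (subset_leq_card (subsetIr _ _)) _.
  by rewrite -setUA !cardsU1 cards1; do 2!case: (_ \notin _).
(* Since [K] has at least [n - 3] edges, at most [rr + 2] steps remain. *)
have m3h : (m.+1 <= 3 * h)%N by rewrite /h; move: cB card_B card_K rpos; clear; lia.
have h0 : (0 < h)%N by rewrite /h addn1.
apply: le_trans (completion_prob_ge (S := K :\: B)
  (f := fun f => gam / h%:R *
    (gam ^+ m * 2^-1 ^+ ((a' \notin f |: B) + (b' \notin f |: B)) / rr%:R)) _ _) => //; last first.
  move=> f fD; have adm := Kadm f fD; have /setDP[fK fB] := fD.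
  rewrite ler_pM ?divr_ge0 ?mulr_ge0 ?exprn_ge0 ?(ltW gam_gt0) ?invr_ge0 //.
    have := step_ge hHs BHs cB h0 m3h hh adm.
    by rewrite (subsetP KH _ fK) mulr1.
  apply: le_trans (IH (f |: B) _ _ _).
  - suff -> : #|K :\: (f |: B)|.+1 = rr by [].
    rewrite /rr (cardsD1 f (K :\: B)) fD add1n; congr (_.+1).
    by rewrite (setDDl K B [set f]) (setUC [set f] B).
  - by rewrite in_setU1 eB orbT.
  - by rewrite subUset Bsub sub1set in_setU1 fK orbT.
  - exact: card_addU1.
(* All [q] missing edges among [a'] and [b'] belong to [K], so each contributes its doubled term to
   the sum. *)
have sum_ge : 2^-1 ^+ q * (rr%:R + q%:R) <=
    \sum_(f in K :\: B) 2^-1 ^+ ((a' \notin f |: B) + (b' \notin f |: B)) :> R.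
  apply: le_trans (_ : \sum_(f in K :\: B) 2^-1 ^+ q * (1 + (f == a')%:R + (f == b')%:R) <= _).
    rewrite -mulr_sumr !big_split /= sumr_const -/rr -addrA.
    have ind x : x \in K -> \sum_(f in K :\: B) (f == x)%:R = (x \notin B)%:R :> R.
      move=> xK; case: (boolP (x \in B)) => xB /=.
        by rewrite big1 // => f /setDP[_ fB]; case: eqP xB fB => // -> ->.
      rewrite (bigD1 x) /=; last by apply/setDP; split.
      rewrite eqxx big1 ?addr0 // => f /andP[_ /negbTE fx].
      by rewrite fx.
    by rewrite !ind // /q natrD.
  by apply: ler_sum => f /setDP[_ fB]; apply: half_pow_ge.
rewrite (eq_bigr (fun f => gam ^+ m.+1 / h%:R / rr%:R *
    2^-1 ^+ ((a' \notin f |: B) + (b' \notin f |: B)))) => [|f _]; last first.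
  by rewrite exprS; move: gam (gam ^+ m) (2^-1 ^+ _ : R) (h%:R^-1 : R) (rr%:R^-1 : R) => *; ring.
rewrite -mulr_sumr.
apply: le_trans (ler_wpM2l _ sum_ge); last first.
  by rewrite !divr_ge0 // exprn_ge0 // ltW // gam_gt0.
have -> : gam ^+ m.+1 / h%:R / rr%:R * (2^-1 ^+ q * (rr%:R + q%:R)) =
  (gam ^+ m.+1 * 2^-1 ^+ q) * (h%:R^-1 / rr%:R * (rr%:R + q%:R)).
  by move: (gam ^+ m.+1) (2^-1 ^+ q : R) => ? ?; ring.
rewrite ler_wpM2l ?mulr_ge0 ?exprn_ge0 ?(ltW gam_gt0) ?invr_ge0 //.
by rewrite /h !natrD -natr1; apply: exchange_ratio_ge; rewrite ?ltr0n ?ler0n.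
Qed.

Let better : pred {set {set 'I_n}} := fun H' => (level H' < level H)%N.
Let n_gt2 : (2 < n)%N. Proof. exact: leq_trans n_ge12. Qed.

(* [D] consists of the two or three edges of [H] that are given up for [e]. *)
Lemma exchange_prob e : exists D : {set {set 'I_n}}, e \in sstar n :\: H ->
  [/\ D \subset H, (2 <= #|D| <= 3)%N &
   forall m B, B \subset H -> [disjoint D & B] -> (#|B| + m.+1)%N = n ->
     admissible n B e /\ gam ^+ m / (4 * m%:R) <= completion_prob P better m (e |: B)].
Proof.
(* For all other [e] the value is a dummy; keeping the condition on [e] under the existential lets
   [choice] turn [D] into a function. *)
have [eD|] := boolP (e \in sstar n :\: H); last by exists set0.
have /setDP[es eH] := eD.
have /eqP/cards2P[u [v [uv Ee]]] := is_ham_edge2 (is_ham_sstar n_gt2) es.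
have [a [b [g [a' [b' [r spec]]]]]] := exchange_sstar n_gt2 hH (eq_ind e (fun x => x \in sstar n :\: H) eD _ Ee).
have [[aH bH gH] [ua ua' vb vb'] [a'K b'K ab'] [ur sr lr Kr]] := spec.
pose D := [set a; b; g]; pose K := H :\: D; exists D => _.
have DH : D \subset H.
  rewrite !subUset !sub1set; move: aH bH gH.
  by rewrite !inE => /andP[_ ->] /andP[_ ->] /andP[_ ->].
have D23 : (2 <= #|D| <= 3)%N.
  (* An edge equal to both would contain [u] and [v], hence be [e], which is not in [H]. *)
  have ab : a != b.
    apply: contra eH => /eqP ab; rewrite Ee (_ : [set u; v] = a); first by case/setDP: aH.
    apply/eqP; rewrite eqEcard subUset !sub1set ua ab vb cards2 uv /=.
    by rewrite (is_ham_edge2 hH) //; case/setDP: bH.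
  rewrite /D -setUA !cardsU1 cards1 !inE negb_or ab /=.
  case: (a =P g) => [ag|_]; case: (b =P g) => [bg|_] //.
  by move: ab; rewrite ag bg eqxx.
have KH : K \subset H by exact: subsetDl.
split=> // m B BH DB cB.
have eB : e \notin B by apply: contra eH; exact: (subsetP BH).
have BK : B \subset K by rewrite subsetD BH disjoint_sym.
pose Hs := cycle_edges v r.
have hHs : is_ham n Hs := is_ham_cycle_edges (is_ham_gt2 hH) ur sr.
have eKs : e |: K \subset Hs by rewrite /Hs /cycle_edges lr -Ee; apply: setUS.
have KBm : (#|K :\: B| + #|D| = m.+1)%N.
  have DHB : D \subset H :\: B by rewrite subsetD DH.
  rewrite -(sub_ham_cardD BH cB) -(cardsID D (H :\: B)) (setIidPr DHB) addnC.
  by rewrite /K (setDDl H D B) (setDDl H B D) (setUC D B).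
have KBm1 : (#|K :\: (e |: B)|.+1 <= m)%N.
  have : (#|K :\: (e |: B)| <= #|K :\: B|)%N by apply/subset_leq_card/setDS/subsetUr.
  by move: KBm D23; clear; lia.
split; first by apply: (admissible_sub_ham hHs) eB; apply: subset_trans eKs; apply: setUS.
apply: le_trans (after_exchange_ge spec _ _ _ _ _); rewrite -?Ee //.
- rewrite -/D -/K -mulrA ler_wpM2l ?exprn_ge0 ?(ltW gam_gt0) // invfM.
  apply: ler_pM; rewrite ?invr_ge0 //; last first.
    by rewrite lef_pV2 ?posrE ?ltr0n ?ler_nat // (leq_trans _ KBm1).
  exact: quarter_le_half_exp.
- move=> H' hH' sub; apply: (level_lt n_gt2 hH hH' eD); apply: subset_trans sub.
  rewrite Ee -/D -/K; apply: setUS; rewrite /K subsetD subsetIl disjoint_sym /D.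
  rewrite disjoints_subset !subUset !sub1set !in_setC.
  by move: aH bH gH => /setDP[_ ->] /setDP[_ ->] /setDP[_ ->].
- by rewrite setU11.
- by rewrite -/D -/K setUS.
- exact: card_addU1.
Qed.

(* The induction conditions on the first chosen edge: it is either in [H], or one of the
   edges [e] of the optimal tour for which [D e] has not been touched yet. *)
Lemma partial_improve_ge : exists D : {set 'I_n} -> {set {set 'I_n}}, forall m B,
  B \subset H -> (#|B| + m)%N = n ->
  #|[set e in sstar n :\: H | [disjoint D e & B]]|%:R * gam ^+ m / (16 * n%:R ^+ 2 * m%:R)
    <= completion_prob P better m B.
Proof.
have [D DP] := choice exchange_prob; exists D.
elim=> [|m IH] B BH cB.
  (* For [m = 0] the claimed bound is 0, as the inverse of 0 is 0. *)
  by rewrite mulr0 invr0 mulr0 (completion_prob_ge0 PiH_gt0).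
pose E B := [set e in sstar n :\: H | [disjoint D e & B]].
rewrite -/(E B); have [E0|Epos] := posnP #|E B|.
  by rewrite E0 !mul0r (completion_prob_ge0 PiH_gt0).
(* At least two edges of some [D e] are still to be drawn, so one step leaves [m > 0]. *)
have m0 : (0 < m)%N.
  have /card_gt0P[e] := Epos; rewrite inE => /andP[/DP[DH D23 _] DB].
  have : (#|D e| <= m.+1)%N.
    by rewrite -(sub_ham_cardD BH cB); apply: subset_leq_card; rewrite subsetD DH.
  by move: D23; clear; lia.
have EH : [disjoint H :\: B & E B].
  rewrite disjoint_subset; apply/subsetP => x /setDP[xH _].
  by rewrite !inE xH.
(* Common unit of all contributions. A first edge [x] in [H] gives [w] times the number of optimal
   edges still available after it; a first edge in [E B] gives [4 * w], which outweighs the loss of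
   up to 3 in [cnt]. *)
pose w : R := gam ^+ m.+1 / (16 * n%:R ^+ 2 * m%:R * m.+1%:R).
have w0 : 0 <= w.
  by rewrite divr_ge0 ?exprn_ge0 ?(ltW gam_gt0) ?mulr_ge0 ?exprn_ge0.
have nR0 : n%:R != 0 :> R by rewrite pnatr_eq0 -lt0n (leq_trans _ n_gt2).
have mR0 : m%:R != 0 :> R by rewrite pnatr_eq0 -lt0n.
have mR1 : m.+1%:R != 0 :> R by rewrite pnatr_eq0.
apply: le_trans (completion_prob_ge (S := (H :\: B) :|: E B)
  (f := fun x => w * (if x \in H then #|E (x |: B)|%:R else 4)) _ _).
- rewrite -mulr_sumr [X in _ <= w * X](eq_bigl [predU H :\: B & E B]); last first.
    by move=> x; rewrite !inE.
  rewrite bigU //=.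
  rewrite [X in w * (X + _)](eq_bigr (fun x => #|E (x |: B)|%:R)); last first.
    by move=> x /setDP[-> _].
  rewrite [X in w * (_ + X)](eq_bigr (fun=> 4)); last first.
    by move=> x; rewrite inE => /andP[/setDP[_ /negbTE ->]].
  rewrite sumr_const -natr_sum -[4 *+ _]mulr_natr.
  (* Double counting of the pairs of [x] in [H :\: B] and [e] in [E B] with [x] outside [D e]: each
     [e] misses at most three [x]. *)
  have cnt : (#|E B| * m.+1 <= \sum_(x in H :\: B) #|E (x |: B)| + 3 * #|E B|)%N.
    have -> : (\sum_(x in H :\: B) #|E (x |: B)| = \sum_(e in E B) #|(H :\: B) :\: D e|)%N.
      rewrite (eq_bigr (fun x => \sum_(e in E B) (x \notin D e))%N) => [|x _]; last first.
        rewrite -sum1_card -big_mkcondr /=; apply: eq_bigl => e.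
        by rewrite !inE disjoint_setU1r [(x \notin _) && _]andbC !andbA.
      rewrite exchange_big /=; apply: eq_bigr => e _.
      rewrite -sum1_card -big_mkcondr /=; apply: eq_bigl => x.
      by rewrite !inE andbC.
    rewrite -sum_nat_const -[(3 * _)%N]mulnC -sum_nat_const -big_split /=; apply: leq_sum => e.
    rewrite inE => /andP[/DP[DH D23 _] DB].
    have DHB : D e \subset H :\: B by rewrite subsetD DH.
    by rewrite cardsD (setIidPr DHB) (sub_ham_cardD BH cB); move: D23; clear; lia.
  have cntR : (#|E B| * m.+1)%:R <=
      (\sum_(x in H :\: B) #|E (x |: B)| + 3 * #|E B|)%:R :> R by rewrite ler_nat.
  rewrite natrM natrD natrM in cntR.
  apply: le_trans (_ : w * (#|E B|%:R * (m.+1%:R + 1)) <= _); last first.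
    by rewrite ler_wpM2l // mulrDr mulr1; lra.
  rewrite (_ : _ / _ = w * (#|E B|%:R * m%:R)); last first.
    rewrite /w; move: (n%:R : R) (m%:R : R) (m.+1%:R : R) nR0 mR0 mR1
      (gam ^+ m.+1) (#|E B|%:R : R) => x y z x0 y0 z0 p N.
    by field; rewrite x0 y0 z0.
  by rewrite ler_wpM2l // ler_wpM2l // -natr1; lra.
- by move=> e; rewrite in_setU => /orP[/(admissible_in_ham BH) //|]; rewrite inE =>
    /andP[/DP[_ _ /(_ m B BH)] DB /DB/(_ cB)[]].
- move=> x; rewrite in_setU => /orP[xD|xE].
    have adm := admissible_in_ham BH xD; have /setDP[xH xB] := xD.
    have := step_ge hH BH cB (ltn0Sn m) _ (admissible_ham_le BH cB) adm.
    rewrite xH mulr1 leq_pmull // => /(_ isT) st.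
    have xBH : x |: B \subset H by rewrite subUset sub1set xH.
    have := IH (x |: B) xBH (card_addU1 xB cB); rewrite -/(E _) => ih.
    rewrite (_ : w * _ = gam / m.+1%:R * (#|E (x |: B)|%:R * gam ^+ m / (16 * n%:R ^+ 2 * m%:R))).
      apply: ler_pM => //; first by rewrite divr_ge0 ?(ltW gam_gt0).
      by rewrite divr_ge0 ?mulr_ge0 ?exprn_ge0 ?(ltW gam_gt0).
    rewrite /w exprS; move: (n%:R : R) (m%:R : R) (m.+1%:R : R) nR0 mR0 mR1
      (gam ^+ m) (#|E (x |: B)|%:R : R) gam => x1 y z x0 y0 z0 p N q.
    by field; rewrite x0 y0 z0.
  have /andP[xs DB] : (x \in sstar n :\: H) && [disjoint D x & B] by move: xE; rewrite inE.
  have [_ _ /(_ m B BH DB cB)[adm fin]] := DP x xs.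
  have /setDP[_ xH] := xs.
  have := step_ge hH BH cB (ltn0Sn m) _ (admissible_ham_le BH cB) adm.
  rewrite (negbTE xH) leq_pmull // => /(_ isT) st.
  rewrite (_ : w * _ = gam / m.+1%:R * (n%:R ^+ 2)^-1 * (gam ^+ m / (4 * m%:R))).
    apply: ler_pM => //; first by rewrite !divr_ge0 ?(ltW gam_gt0) ?exprn_ge0.
    by rewrite divr_ge0 ?mulr_ge0 ?exprn_ge0 ?(ltW gam_gt0).
  rewrite /w exprS; move: (n%:R : R) (m%:R : R) (m.+1%:R : R) nR0 mR0 mR1
      (gam ^+ m) gam => x1 y z x0 y0 z0 p q.
  by field; rewrite x0 y0 z0.
Qed.

Lemma improve_ge : (level H)%:R * gam ^+ n / (16 * n%:R ^+ 3) <= completion_prob P better n set0.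
Proof.
have [D /(_ n set0 (sub0set _))] := partial_improve_ge.
rewrite cards0 => /(_ erefl); rewrite -(card_sstar_diff n_gt2 hH) -[16 * _ * n%:R]mulrA -exprSr.
suff -> : [set e in sstar n :\: H | [disjoint D e & set0]] = sstar n :\: H by [].
by apply/setP => e; rewrite inE -setI_eq0 setI0 eqxx andbT.
Qed.

Lemma gam_exp_ge : expR (- 8) <= gam ^+ n.
Proof.
have gam0 : 0 < 1 + 8 / n%:R :> R by rewrite -invr_gt0 gam_gt0.
rewrite /gam exprVn expRN lef_pV2 ?posrE ?expR_gt0 ?exprn_gt0 //.
rewrite -[X in expR X](_ : n%:R * (8 / n%:R) = 8); last first.
  by rewrite mulrC divfK // pnatr_eq0 -lt0n (leq_trans _ n_gt2).
by rewrite expRM_natl lerXn2r ?nnegrE ?expR_ge0 ?expR_ge1Dx // ltW.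
Qed.

Lemma egen_reproduce_ge : expR (- 8) <= egen R n (PiH R n H) H.
Proof.
apply: le_trans gam_exp_ge _.
have := @reproduce_ge n set0 (sub0set _); rewrite cards0 => /(_ erefl).
by rewrite -sum_egen big_pred1_eq.
Qed.

Lemma egen_improve_ge : (level H)%:R * expR (- 8) / (16 * n%:R ^+ 3) <=
  \sum_(H' : {set {set 'I_n}} | (level H' < level H)%N) egen R n (PiH R n H) H'.
Proof.
apply: le_trans (_ : (level H)%:R * gam ^+ n / (16 * n%:R ^+ 3) <= _).
  by rewrite ler_wpM2r ?invr_ge0 ?mulr_ge0 ?exprn_ge0 // ler_wpM2l // gam_exp_ge.
by apply: le_trans improve_ge _; rewrite -sum_egen.
Qed.

End EdgeBounds.

(** * The edge-based generation as a distribution on tours *)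

Section EgenDistribution.
Variables (R : realType) (n : nat) (P : pmat R n).
Hypothesis n_gt2 : (2 < n)%N.
Hypothesis P_gt0 : forall i j, i != j -> 0 < P i j.

Lemma egen_ge0 H : 0 <= egen R n P H.
Proof.
have := completion_prob_ge0 P_gt0 (pred1 H) n set0.
by rewrite -sum_egen big_pred1_eq.
Qed.

Let hs := is_ham_sstar n_gt2.

Lemma sum_egen_all : \sum_(H : {set {set 'I_n}}) egen R n P H = 1.
Proof. by rewrite sum_egen (completion_prob1 P_gt0 hs) ?sub0set ?cards0. Qed.

(** Drawing something other than [H] is certain, since the outcome is always a tour. *)
Lemma egen_not_ham H : ~ is_ham n H -> egen R n P H = 0.
Proof.
move=> nH; have := sum_egen P [pred H' | H' != H].
rewrite (completion_prob1 P_gt0 hs) ?sub0set ?cards0 //; last first.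
  by move=> H' hH' _; apply/negP => /eqP E; rewrite E in hH'.
move=> E; have := sum_egen_all; rewrite (bigD1 H) //= E => E1.
by rewrite -[LHS](addrK 1) E1 subrr.
Qed.

End EgenDistribution.

(** * Vertex-based generation *)

Section VertexDistribution.
Variables (R : realType) (n : nat) (P : pmat R n).
Hypothesis n_gt2 : (2 < n)%N.
Hypothesis P_gt0 : forall i j, i != j -> 0 < P i j.
Implicit Types (s : {perm 'I_n}) (k : 'I_n).

Lemma val_ord_pred k : (0 < k)%N -> ord_pred k = k.-1 :> nat.
Proof.
move=> k0; rewrite /= -[X in (X + n)%N](prednK k0) addSn /= modnDr modn_small //.
by rewrite (leq_ltn_trans (leq_pred k)).
Qed.

Let D s k := \sum_(j < n | (k <= j)%N) P (s (ord_pred k)) (s j).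
Let p s k := P (s (ord_pred k)) (s k) / D s k.

Let prev_neq s k (j : 'I_n) : (0 < k)%N -> (k <= j)%N -> s (ord_pred k) != s j.
Proof.
move=> k0 kj; rewrite (inj_eq perm_inj); apply/negP => /eqP/(congr1 (@nat_of_ord n)).
by rewrite val_ord_pred // => E; move: kj; rewrite -E leqNgt ltn_predL k0.
Qed.

Lemma vertex_denominator_gt0 s k : (0 < k)%N ->
  0 < \sum_(j < n | (k <= j)%N) P (s (ord_pred k)) (s j).
Proof.
move=> k0; rewrite (bigD1 k) //= ltr_pwDl ?P_gt0 ?prev_neq //.
by apply: sumr_ge0 => j /andP[kj _]; rewrite ltW ?P_gt0 ?prev_neq.
Qed.

Let agree m s s0 := [forall i : 'I_n, (i < m)%N ==> (s i == s0 i)].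

Let agreeP m s s0 : reflect (forall i : 'I_n, (i < m)%N -> s i = s0 i) (agree m s s0).
Proof.
apply: (iffP forallP) => [h i im|h i]; first by have := h i; rewrite im => /eqP.
by apply/implyP => im; rewrite h.
Qed.

Let sum_agree (F : 'I_n -> R) m s s0 : agree m s s0 ->
  \sum_(j < n | (m <= j)%N) F (s j) = \sum_(j < n | (m <= j)%N) F (s0 j).
Proof.
move/agreeP => ag.
have tot (t : {perm 'I_n}) :
    \sum_(j < n | (m <= j)%N) F (t j) + \sum_(j < n | (j < m)%N) F (t j) = \sum_j F j.
  rewrite [RHS](reindex_inj (@perm_inj _ t)) /= [RHS](bigID (fun j : 'I_n => (m <= j)%N)) /=.
  by congr (_ + _); apply: eq_bigl => j; rewrite -ltnNge.
apply: (addIr (\sum_(j < n | (j < m)%N) F (s j))).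
rewrite tot -(tot s0); congr (_ + _); apply: eq_bigr => j jm.
by rewrite ag.
Qed.

(** Given the first [m] vertices, the choices of the next one have probabilities summing to 1, since
    by [sum_agree] the denominator depends only on the common prefix. *)
Let sum_completions i m s0 : (m + i = n)%N -> (0 < m)%N ->
  \sum_(s | agree m s s0) \prod_(k < n | (m <= k)%N) p s k = 1.
Proof.
elim: i m s0 => [|i IH] m s0 mi m0.
  rewrite addn0 in mi; rewrite (big_pred1 s0) => [|s]; last first.
    apply/agreeP/eqP => [ag|-> //]; apply/perm.permP => j.
    by apply: ag; rewrite mi.
  by rewrite big_pred0 // => k; rewrite leqNgt mi ltn_ord.
have mn : (m < n)%N by rewrite -[X in (_ < X)%N]mi addnS ltnS leq_addr.
pose km := Ordinal mn.
rewrite (partition_big (fun s => (s0^-1)%g (s km)) predT) //=.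
have part (j : 'I_n) : \sum_(s | agree m s s0 && ((s0^-1)%g (s km) == j))
    \prod_(k < n | (m <= k)%N) p s k =
  if (m <= j)%N then P (s0 (ord_pred km)) (s0 j) / D s0 km else 0.
  case: leqP => mj; last first.
    rewrite big_pred0 // => s; apply/negP => /andP[/agreeP ag /eqP E].
    have : s j = s km by rewrite ag // -E permKV.
    by move/perm_inj/(congr1 (@nat_of_ord n)) => /= E'; move: mj; rewrite E' ltnn.
  (* A representative of the prefix extended by [s0 j]: the transposition moves this vertex to place
     [m] and leaves the earlier places alone. *)
  pose sj := (tperm km j * s0)%g.
  have agE s : agree m s s0 && ((s0^-1)%g (s km) == j) = agree m.+1 s sj.
    apply/andP/agreeP => [[/agreeP ag /eqP E] x|ag].
      rewrite ltnS leq_eqVlt => /orP[/eqP xm|xm].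
        have -> : x = km by apply: val_inj.
        by rewrite permM tpermL -E permKV.
      rewrite permM tpermD; first exact: ag.
        by apply/eqP => E'; move: xm; rewrite -E' /= ltnn.
      by apply/eqP => E'; move: xm; rewrite -E' ltnNge mj.
    split; last by rewrite ag //= permM tpermL permK.
    apply/agreeP => x xm; rewrite ag ?(ltn_trans xm) // permM tpermD //.
      by apply/eqP => E'; move: xm; rewrite -E' /= ltnn.
    by apply/eqP => E'; move: xm; rewrite -E' ltnNge mj.
  rewrite (eq_bigl _ _ agE) -[RHS]mulr1 -[X in _ = _ * X](IH m.+1 sj) ?addSnnS // mulr_sumr.
  apply: eq_bigr => s; rewrite -agE => /andP[ag /eqP E]; rewrite (bigD1 km) //=.
  congr (_ * _); last first.
    by apply: eq_bigl => k; rewrite ltn_neqAle andbC eq_sym.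
  rewrite /p; have -> : s km = s0 j by rewrite -E permKV.
  have -> : s (ord_pred km) = s0 (ord_pred km).
    by apply: (agreeP _ _ _ ag); rewrite val_ord_pred //= prednK.
  rewrite /D; congr (_ / _).
  have -> : s (ord_pred km) = s0 (ord_pred km).
    by apply: (agreeP _ _ _ ag); rewrite val_ord_pred //= prednK.
  exact: (sum_agree (fun w => P (s0 (ord_pred km)) w) ag).
rewrite (eq_bigr _ (fun j _ => part j)) -big_mkcond /= -mulr_suml divff //.
by rewrite gt_eqF //; exact: (@vertex_denominator_gt0 s0 km).
Qed.

Lemma sum_vprob : \sum_s vprob R n P s = 1.
Proof.
have n0 : (0 < n)%N by apply: leq_trans n_gt2.
pose k0 : 'I_n := Ordinal n0.
rewrite /vprob -mulr_sumr (partition_big (fun s => s k0) predT) //=.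
rewrite (eq_bigr (fun=> 1)) => [|w _]; last first.
  rewrite -[RHS](@sum_completions n.-1 1 (tperm k0 w)) ?add1n ?prednK //.
  apply: eq_bigl => s; apply/eqP/agreeP => [sw x|ag]; last by rewrite ag ?tpermL.
  by rewrite ltnS leqn0 => /eqP x0; rewrite (_ : x = k0) ?tpermL //; apply: val_inj.
by rewrite sumr_const card_ord mul1r mulVf // pnatr_eq0 -lt0n.
Qed.

Lemma vprob_ge0 s : 0 <= vprob R n P s.
Proof.
rewrite /vprob mulr_ge0 ?divr_ge0 //; apply: prodr_ge0 => k k0.
by rewrite divr_ge0 ?ltW ?vertex_denominator_gt0 ?P_gt0 ?prev_neq.
Qed.

Lemma sum_vgen t : \sum_(H : {set {set 'I_n}} | t H) vgen R n P H =
  \sum_(s : {perm 'I_n} | t (cyc_edges n n s)) vprob R n P s.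
Proof.
rewrite [RHS](partition_big (fun s : {perm 'I_n} => cyc_edges n n s) t) //=.
apply: eq_bigr => H tH; apply: eq_bigl => s.
by case: eqP => [->|]; rewrite ?tH ?andbF.
Qed.

Lemma vgen_ge0 H : 0 <= vgen R n P H.
Proof. by apply: sumr_ge0 => s _; exact: vprob_ge0. Qed.

Lemma sum_vgen_all : \sum_(H : {set {set 'I_n}}) vgen R n P H = 1.
Proof. by rewrite sum_vgen sum_vprob. Qed.

Lemma vgen_not_ham H : ~ is_ham n H -> vgen R n P H = 0.
Proof.
move=> nH; rewrite /vgen big_pred0 // => s; apply/negP => /eqP E.
by apply: nH; split=> //; exists s.
Qed.

End VertexDistribution.

Lemma denominator_excess_le (R : realFieldType) (x : R) :
  12 <= x -> x / ((x - 1) * (x - 2)) <= 2 / x.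
Proof.
move=> x12; rewrite ler_pdivrMr; last by rewrite mulr_gt0; lra.
rewrite mulrAC ler_pdivlMr; last by lra.
nra.
Qed.

(** * Lower bounds for the vertex-based generation *)

Section VertexBounds.
Variables (R : realType) (n : nat) (H : {set {set 'I_n}}).
Hypothesis n_ge12 : (12 <= n)%N.
Hypothesis hH : is_ham n H.
Implicit Types (s : {perm 'I_n}) (k : 'I_n).

Let P := PiH R n H.
Let c := pi_max R n.
Let d := pi_min R n.
Let del : R := 1 + 2 / n%:R.
Let n_gt2 : (2 < n)%N. Proof. exact: leq_trans n_ge12. Qed.
Let nR : (12 : R) <= n%:R. Proof. by rewrite ler_nat. Qed.
Let c0 : 0 < c. Proof. exact: pi_max_gt0. Qed.
Let d0 : 0 < d. Proof. exact: pi_min_gt0. Qed.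
Let P_gt0 : forall i j, i != j -> 0 < P i j. Proof. exact: PiH_gt0. Qed.

Let good s k := [set s (ord_pred k); s k] \in H.

Lemma card_ham_neighbours u : (#|[set w | [set u; w] \in H]| <= 2)%N.
Proof.
apply: leq_trans (is_ham_deg u hH); rewrite /deg.
rewrite -(card_in_imset (f := fun w => [set u; w])).
  apply: subset_leq_card; apply/subsetP => _ /imsetP[w + ->].
  by rewrite !inE eqxx => ->.
move=> w w'; rewrite !inE => /(is_ham_edge2 hH) uw /(is_ham_edge2 hH) uw' /setP E.
move: uw; rewrite cards2; case: eqP => // uw _.
by have := E w; rewrite !inE eqxx orbT => /esym/orP[/eqP wu|/eqP //]; case: uw.
Qed.

Lemma sum_PiH_le u (A : pred 'I_n) h : (#|[set w | [set u; w] \in H & A w]| <= h)%N ->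
  \sum_(w | A w) P u w <= c * h%:R + n%:R * d.
Proof.
move=> Ah; apply: (@le_trans _ _ (\sum_(w | A w) ((if [set u; w] \in H then c else 0) + d))).
  apply: ler_sum => w _; rewrite /P /PiH; case: eqP => _; case: ifP => _.
  - by rewrite addr_ge0 // ltW.
  - by rewrite add0r ltW.
  - by rewrite lerDl ltW.
  - by rewrite add0r.
rewrite big_split /=; apply: lerD.
  rewrite -big_mkcondr sumr_const -[_ *+ _]mulr_natr ler_wpM2l ?(ltW c0) // ler_nat.
  by apply: leq_trans Ah; apply: subset_leq_card; apply/subsetP => w; rewrite !inE andbC.
rewrite sumr_const -[_ *+ _]mulr_natl ler_wpM2r ?(ltW d0) // ler_nat.
by apply: leq_trans (max_card _) _; rewrite card_ord.
Qed.

Lemma del_ge1 : 1 <= del.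
Proof. by rewrite /del lerDl divr_ge0. Qed.

Let del_gt0 : 0 < del. Proof. exact: lt_le_trans del_ge1. Qed.

Let nd_le : n%:R * d <= c * (2 / n%:R).
Proof.
rewrite /d pi_minE // -/c mulrCA ler_wpM2l ?(ltW c0) //.
exact: denominator_excess_le nR.
Qed.

(* After a step along an edge of [H] at most one neighbour in [H] is still unvisited. *)
Lemma vertex_denominator_le s k : (0 < k)%N ->
  \sum_(j < n | (k <= j)%N) P (s (ord_pred k)) (s j) <=
  c * del * (if (0 < ord_pred k)%N && good s (ord_pred k) then 1 else 2).
Proof.
move=> k0; set u := s (ord_pred k).
pose A := [pred w | (k <= (s^-1)%g w)%N].
have -> : \sum_(j < n | (k <= j)%N) P u (s j) = \sum_(w | A w) P u w.
  rewrite [RHS](reindex_inj (@perm_inj _ s)); apply: eq_bigl => j.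
  by rewrite /= permK.
have sub : (#|[set w | [set u; w] \in H & A w]| <= 2)%N.
  apply: leq_trans (card_ham_neighbours u); apply: subset_leq_card.
  by apply/subsetP => w; rewrite !inE => /andP[].
have vp := val_ord_pred k0.
have cdE : c * del = c + c * (2 / n%:R) by rewrite /del mulrDr mulr1.
case: ifP => [/andP[p0 gd]|_].
  have vpp := val_ord_pred p0.
  have sub1 : (#|[set w | [set u; w] \in H & A w]| <= 1)%N.
    have : s (ord_pred (ord_pred k)) \in [set w | [set u; w] \in H] :\: [set w | [set u; w] \in H & A w].
      have gd' : [set u; s (ord_pred (ord_pred k))] \in H by rewrite setUC.
      rewrite !inE gd' /= permK andbT -ltnNge vpp vp.
      by move: k0; clear; case: (k : nat) => // m _; rewrite /= ltnS leq_pred.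
    move=> x; have := card_ham_neighbours u.
    rewrite -(cardsID [set w | [set u; w] \in H & A w]) (cardsD1 (s (ord_pred (ord_pred k))) (_ :\: _)) x.
    rewrite (setIidPr _); last by apply/subsetP => w; rewrite !inE => /andP[].
    by clear; lia.
  by apply: le_trans (sum_PiH_le sub1) _; rewrite !mulr1 cdE lerD2l.
apply: le_trans (sum_PiH_le sub) _; rewrite cdE (mulrDl c) lerD2l.
apply: le_trans nd_le _; rewrite ler_peMr ?mulr_ge0 ?divr_ge0 ?(ltW c0) //.
by rewrite ler1n.
Qed.

(** Price of a step off [H]: [n ^- 2] for the light edge, and [1 / 2] because both tour neighbours
    of the vertex reached may still be unvisited and compete in the next step. *)
Let t : R := (2 * n%:R ^+ 2)^-1.

Let n_gt0R : 0 < n%:R :> R. Proof. by rewrite ltr0n (leq_trans _ n_gt2). Qed.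

(** The start costs [1 / n] for its choice and [1 / 2] for having both tour neighbours unvisited;
    [expR (- 2)] bounds the powers of [del]. *)
Lemma vprob_ge s : (2 * n%:R)^-1 * (expR (- 2) * t ^+ #|[set k : 'I_n | (0 < k)%N && ~~ good s k]|)
  <= vprob R n P s.
Proof.
(* [z k] depends on how place [k] is reached but enters the denominator of the following step, hence
   [z (ord_pred k)] below; [y k] is the relative weight of the step into [k]. *)
pose z k : R := if (0 < k)%N && good s k then 1 else 2^-1.
pose y k : R := if good s k then 1 else (n%:R ^+ 2)^-1.
have z01 k : 0 <= z k <= 1 by rewrite /z; case: ifP; lra.
have y0 k : 0 <= y k by rewrite /y; case: ifP; rewrite // invr_ge0 exprn_ge0.
have step k : (0 < k)%N -> del^-1 * z (ord_pred k) * y k <=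
    P (s (ord_pred k)) (s k) / \sum_(j < n | (k <= j)%N) P (s (ord_pred k)) (s j).
  move=> k0; have D0 := vertex_denominator_gt0 P_gt0 s k0; rewrite ler_pdivlMr //.
  apply: le_trans (ler_wpM2l _ (vertex_denominator_le s k0)) _.
    by rewrite !mulr_ge0 ?invr_ge0 ?(ltW del_gt0) //; case/andP: (z01 (ord_pred k)).
  have -> : del^-1 * z (ord_pred k) * y k * (c * del *
     (if (0 < ord_pred k)%N && good s (ord_pred k) then 1 else 2)) = c * y k.
    rewrite /z; case: ifP => _; first by field; rewrite lt0r_neq0.
    by field; rewrite lt0r_neq0.
  rewrite /P /PiH (inj_eq perm_inj) (_ : (ord_pred k == k) = false); last first.
    apply/negP => /eqP/(congr1 (@nat_of_ord n)); rewrite val_ord_pred //.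
    by move: k0; clear; case: (k : nat) => //= m _ /n_Sn.
  rewrite -/(good s k) /y; case: ifP => _; first by rewrite mulr1.
  rewrite pi_minE // -/c ler_wpM2l ?(ltW c0) //; exact: inv_sqr_le nR.
have n0 : (0 < n)%N := leq_trans (isT : (0 < 3)%N) n_gt2.
pose k0 : 'I_n := Ordinal n0.
have k0E k : (k != k0) = (0 < k)%N.
  by rewrite lt0n -val_eqE.
have del1 : 0 <= del^-1 <= 1 by rewrite invr_ge0 (ltW del_gt0) invf_le1 // del_ge1.
have prod_del : expR (- 2) <= \prod_(k < n | (0 < k)%N) del^-1.
  rewrite prodr_const; apply: (@le_trans _ _ (del^-1 ^+ n)); last first.
    have /andP[d1 d2] := del1; apply: (ler_wiXn2l d1 d2).
    by apply: leq_trans (max_card _) _; rewrite card_ord.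
  rewrite exprVn expRN lef_pV2 ?posrE ?expR_gt0 ?exprn_gt0 //.
  rewrite -[X in expR X](_ : n%:R * (2 / n%:R) = 2); last by rewrite mulrC divfK // gt_eqF.
  by rewrite expRM_natl lerXn2r ?nnegrE ?expR_ge0 ?expR_ge1Dx // ltW.
(* The index shift trades the last factor, at most 1, for [z k0], which is [2^-1]. *)
have prod_z : 2^-1 * \prod_(k < n | (0 < k)%N) z k <= \prod_(k < n | (0 < k)%N) z (ord_pred k).
  have -> : 2^-1 * \prod_(k < n | (0 < k)%N) z k = \prod_k z k.
    by rewrite [RHS](bigD1 k0) //= (eq_bigl _ _ k0E).
  rewrite (reindex_inj (can_inj (@ord_predK n))) /= (bigD1 k0) //= (eq_bigl _ _ k0E).
  rewrite ler_piMl //; last by case/andP: (z01 (ord_pred k0)).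
  by apply: prodr_ge0 => k _; case/andP: (z01 (ord_pred k)).
have prod_zy : \prod_(k < n | (0 < k)%N) z k * \prod_(k < n | (0 < k)%N) y k =
    t ^+ #|[set k : 'I_n | (0 < k)%N && ~~ good s k]|.
  rewrite -big_split /= -prodr_const; under [RHS]eq_bigl do rewrite inE.
  rewrite [RHS]big_mkcondr; apply: eq_bigr => k k1; rewrite /z /y k1 /=.
  by case: (good s k) => /=; [rewrite mulr1 | rewrite /t [RHS]invfM].
apply: (@le_trans _ _ (1 / n%:R * \prod_(k < n | (0 < k)%N) (del^-1 * z (ord_pred k) * y k))).
  rewrite !big_split /= -prod_zy mul1r.
  have Y0 : 0 <= \prod_(k < n | (0 < k)%N) y k by apply: prodr_ge0.
  have Z0 : 0 <= \prod_(k < n | (0 < k)%N) z k.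
    by apply: prodr_ge0 => k _; case/andP: (z01 k).
  move: prod_del prod_z Y0 Z0.
  move: (\prod_(k < n | (0 < k)%N) y k) (\prod_(k < n | (0 < k)%N) z k)
    (\prod_(k < n | (0 < k)%N) z (ord_pred k)) (\prod_(k < n | (0 < k)%N) del^-1) => Y Z Z' E EE ZZ Y0 Z0.
  rewrite (_ : _ * (_ * (Z * Y)) = n%:R^-1 * (expR (- 2) * (2^-1 * Z) * Y)); last first.
    by rewrite [(2 * _)^-1]invfM; ring.
  rewrite ler_wpM2l ?invr_ge0 // ler_wpM2r // ler_pM ?expR_ge0 //.
  by rewrite mulr_ge0.
rewrite /vprob ler_wpM2l ?divr_ge0 //; apply: ler_prod => k k1.
rewrite step // andbT !mulr_ge0 //; first by case/andP: del1.
by case/andP: (z01 (ord_pred k)).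
Qed.

Let perm_of_list x q : uniq (x :: q) -> size (x :: q) = n ->
  exists2 s : {perm 'I_n}, forall i : 'I_n, s i = nth x (x :: q) i & cyc_edges n n s = cycle_edges x q.
Proof.
move=> uq sz; have finj : injective (fun i : 'I_n => nth x (x :: q) i).
  by move=> i j /eqP; rewrite nth_uniq ?sz // => /eqP/val_inj.
exists (perm finj) => [i|]; first by rewrite permE.
by rewrite -(cyc_edges_nth sz); apply: eq_imset => i; rewrite !permE.
Qed.

(** For each of the [n] start vertices, one permutation follows [H] without any step off it; the sum
    over the starts cancels the factor [1 / n]. *)
Lemma vgen_reproduce_ge : expR (- 2) / 2 <= vgen R n (PiH R n H) H.
Proof.
have n0 : (0 < n)%N := leq_trans (isT : (0 < 3)%N) n_gt2.
pose k0 : 'I_n := Ordinal n0.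
rewrite /vgen (partition_big (fun s : {perm 'I_n} => s k0) predT) //=.
apply: (@le_trans _ _ (\sum_(u < n) (2 * n%:R)^-1 * expR (- 2))).
  rewrite sumr_const card_ord -mulr_natl [(2 * _)^-1]invfM.
  rewrite le_eqVlt; apply/orP; left; apply/eqP; field.
  by rewrite gt_eqF.
apply: ler_sum => u _; have [q [uq sz Eq]] := is_ham_list u hH.
have [s sE cE] := perm_of_list uq sz.
rewrite (bigD1 s) /=; last by rewrite cE -Eq eqxx sE /=.
rewrite -[X in X <= _]addr0; apply: lerD.
  apply: le_trans (vprob_ge s).
  rewrite (_ : [set _ | _] = set0) ?cards0 ?expr0 ?mulr1 //.
  apply/setP => k; rewrite !inE; apply/negP => /andP[_ /negP[]].
  by rewrite /good Eq -cE; apply/imsetP; exists (ord_pred k); rewrite ?ord_predK.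
by apply: sumr_ge0 => s' _; apply: (vprob_ge0 P_gt0).
Qed.

(** The order [v :: r] leaves [{u, v}] as the closing edge, which is not drawn and costs nothing. At
    most two steps leave [H], so the bound is [(2 n)^-1 * expR (- 2) * t ^+ 2]. *)
Lemma vgen_improve_ge : (0 < level H)%N -> expR (- 2) / (8 * n%:R ^+ 5) <=
  \sum_(H' : {set {set 'I_n}} | (level H' < level H)%N) vgen R n (PiH R n H) H'.
Proof.
move=> l0; have /card_gt0P[e eD] : (0 < #|sstar n :\: H|)%N by rewrite (card_sstar_diff n_gt2 hH).
have /setDP[es eH] := eD.
have /eqP/cards2P[u [v [uv Ee]]] := is_ham_edge2 (is_ham_sstar n_gt2) es.
rewrite Ee in eD es eH.
have [a [b [g [a' [b' [r [[aH bH gH] _ _ [ur sr lr Kr]]]]]]]] := exchange_sstar n_gt2 hH eD.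
have [s sE cE] := perm_of_list ur sr.
set K := H :\: [set a; b; g] in Kr.
have eKs : [set u; v] |: K \subset cyc_edges n n s.
  by rewrite cE /cycle_edges lr; apply: setUS.
have hHs : is_ham n (cyc_edges n n s) by split=> //; exists s.
have better : (level (cyc_edges n n s) < level H)%N.
  apply: (level_lt n_gt2 hH hHs eD); apply: subset_trans eKs.
  apply: setUS; rewrite /K subsetD subsetIl disjoint_sym disjoints_subset !subUset !sub1set !in_setC.
  by move: aH bH gH => /setDP[_ ->] /setDP[_ ->] /setDP[_ ->].
rewrite sum_vgen (bigD1 s) //= -[X in X <= _]addr0; apply: lerD; last first.
  by apply: sumr_ge0 => s' _; apply: (vprob_ge0 P_gt0).
apply: le_trans (vprob_ge s).
have bad2 : (#|[set k : 'I_n | (0 < k)%N && ~~ good s k]| <= 2)%N.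
  pose f k := [set s (ord_pred k); s k].
  have finj : injective f.
    move=> k k' E; apply: (can_inj (@ord_predK n)); apply: (cyc_edge_inj (@perm_inj _ s) n_gt2).
    by rewrite !ord_predK.
  have fs k : f k \in cyc_edges n n s by apply/imsetP; exists (ord_pred k); rewrite ?ord_predK.
  have n0 : (0 < n)%N := leq_trans (isT : (0 < 3)%N) n_gt2.
  (* [ord_pred] wraps around at place 0, so [f] yields the closing edge there. *)
  have f0 : f (Ordinal n0) = [set u; v].
    rewrite /f !sE /= -lr; congr [set _; _].
    rewrite (_ : (0 + n).-1 %% n = (size (v :: r)).-1)%N ?nth_last //=.
    by rewrite add0n modn_small ?ltn_predL //; exact: (esym (congr1 predn sr)).
  rewrite -(card_imset _ finj).
  apply: leq_trans (_ : #|(cyc_edges n n s :\ [set u; v]) :\: K| <= _)%N.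
    apply: subset_leq_card; apply/subsetP => _ /imsetP[k + ->]; rewrite inE => /andP[k0 gk].
    rewrite !inE fs andbT negb_and.
    rewrite gk orbT /= -f0 (inj_eq finj) -val_eqE /= -lt0n k0.
    by [].
  rewrite cardsD (setIidPr _); last first.
    rewrite subsetD1 (subset_trans (subsetUr _ _) eKs) /=.
    by apply: contra eH => /setDP[].
  have := cardsD1 [set u; v] (cyc_edges n n s); rewrite (subsetP eKs) ?setU11 // (is_ham_card hHs).
  have : (n <= #|K| + 3)%N.
    rewrite -[X in (X <= _)%N](is_ham_card hH) -(cardsID [set a; b; g] H) -/K addnC leq_add2l.
    apply: leq_trans (subset_leq_card (subsetIr _ _)) _.
    by rewrite -setUA !cardsU1 cards1; do 2!case: (_ \notin _).
  by rewrite add1n => nK En; rewrite leq_subLR -ltnS -addnS -En.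
have t01 : 0 <= t <= 1.
  rewrite /t invr_ge0 invf_le1 ?mulr_gt0 ?exprn_gt0 // mulr_ge0 ?exprn_ge0 //=.
  by rewrite mulr_ege1 ?exprn_ege1 ?ler1n // (leq_trans _ n_gt2).
have /andP[t0 t1] := t01.
apply: (@le_trans _ _ ((2 * n%:R)^-1 * (expR (- 2) * t ^+ 2))).
  rewrite /t le_eqVlt; apply/orP; left; apply/eqP; field.
  by rewrite gt_eqF.
rewrite ler_wpM2l ?invr_ge0 ?mulr_ge0 // ler_wpM2l ?expR_ge0 //.
exact: ler_wiXn2l.
Qed.

End VertexBounds.

(** * The iteration *)

Lemma sum_tuple_prod (R : comPzRingType) (E : finType) (N : nat) (g : E -> R) :
  \sum_(t : N.-tuple E) \prod_(i < N) g (tnth t i) = (\sum_x g x) ^+ N.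
Proof.
rewrite -[N in RHS]card_ord -prodr_const bigA_distr_bigA /=.
rewrite (reindex (fun f : {ffun 'I_N -> E} => [tuple f i | i < N])) /=; last first.
  exists (fun t : N.-tuple E => [ffun i => tnth t i]) => [f _|t _].
    by apply/ffunP => i; rewrite ffunE tnth_mktuple.
  by apply/eq_from_tnth => i; rewrite tnth_mktuple ffunE.
by apply: eq_bigr => f _; apply: eq_bigr => i _; rewrite tnth_mktuple.
Qed.

Lemma sum_tuple_prod_all (R : comPzRingType) (E : finType) (N : nat) (g : E -> R) (A : pred E) :
  \sum_(t : N.-tuple E | all A t) \prod_(i < N) g (tnth t i) = (\sum_(x | A x) g x) ^+ N.
Proof.
rewrite [X in X ^+ N]big_mkcond -sum_tuple_prod big_mkcond; apply: eq_bigr => t _.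
case: (boolP (all A t)) => [/all_tnthP At|/all_tnthP nA].
  by apply: eq_bigr => i _; rewrite At.
have [i nAi] : exists i, ~~ A (tnth t i).
  by apply/existsP; apply: contraPT nA; rewrite negb_exists => /forallP h; apply=> i; rewrite -[A _]negbK.
by rewrite (bigD1 i) //= (negbTE nAi) mul0r.
Qed.

(** * The level argument for an abstract generation rule *)

Section Levels.
Variables (R : realType) (n : nat).
Hypothesis n_gt2 : (2 < n)%N.
Notation esol := {set {set 'I_n}}.
Variables (gen : pmat R n -> esol -> R) (N : nat) (sel : N.-tuple esol -> esol).
Hypotheses (N_gt0 : (0 < N)%N) (selP : sel_ok R n N sel).

Definition is_distribution (g : esol -> R) :=
  [/\ forall H, 0 <= g H, forall H, ~ is_ham n H -> g H = 0 & \sum_H g H = 1].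

Variables (c1 : R) (p : nat -> R) (L : nat -> nat).
Hypothesis gen_Pi0 : is_distribution (gen (Pi0 R n)).
Hypothesis gen_PiH : forall H, is_ham n H -> is_distribution (gen (PiH R n H)).
Hypothesis gen_reproduce : forall H, is_ham n H -> c1 <= gen (PiH R n H) H.
Hypothesis gen_improve : forall H, is_ham n H -> (0 < level H)%N ->
  p (level H) <= \sum_(H' : esol | (level H' < level H)%N) gen (PiH R n H) H'.

Let err : R := (1 - c1) ^+ N.
Let q k : R := (1 - p k) ^+ N.

Hypothesis err_ge0 : 0 <= err.
Hypothesis q_ge0 : forall k, 0 <= q k.

(* [M] counts iterations, whereas [find_prob] with argument [T] runs [T.+1] of them. *)
Definition failure_prob M P : R := if M is T.+1 then 1 - find_prob R n gen N sel T P else 1.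

Let weight P (t : N.-tuple esol) := \prod_(i < N) gen P (tnth t i).

Lemma sum_weight P : is_distribution (gen P) -> \sum_t weight P t = 1.
Proof. by case=> _ _ g1; rewrite /weight sum_tuple_prod g1 expr1n. Qed.

Lemma failure_probS M P : is_distribution (gen P) ->
  failure_prob M.+1 P = \sum_t weight P t *
    (if `[< optimal R n (sel t) >] then 0 else failure_prob M (PiH R n (sel t))).
Proof.
move=> dP; rewrite [LHS]/failure_prob -[X in X - _](sum_weight dP).
case: M => [|M] /=; rewrite -sumrB; apply: eq_bigr => t _; rewrite -/(weight P t);
  by case: ifP => _; rewrite ?mulr1 ?mulr0 ?subr0 ?subrr // mulrBr mulr1.
Qed.

Lemma weight_ge0 P t : is_distribution (gen P) -> 0 <= weight P t.
Proof. by case=> g0 _ _; apply: prodr_ge0 => i _. Qed.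

Lemma weight_not_ham P t x : is_distribution (gen P) -> x \in t -> ~ is_ham n x -> weight P t = 0.
Proof.
case=> _ gn _ /tnthP[i ->] nh; rewrite /weight (bigD1 i) //= gn ?mul0r //.
Qed.

(** Reduces termwise estimates to tuples of tours, the only ones for which levels and costs
    correspond. *)
Lemma weight_all_ham P t : is_distribution (gen P) ->
  (forall x, x \in t -> is_ham n x) \/ weight P t = 0.
Proof.
move=> dP; have [w0|/eqP w0] := eqVneq (weight P t) 0; first by right.
by left=> x xt; apply: contrapT => /(weight_not_ham dP xt).
Qed.

Lemma failure_prob_le1 M P : is_distribution (gen P) -> failure_prob M P <= 1.
Proof.
elim: M P => [|M IH] P dP //; rewrite failure_probS // -(sum_weight dP).
apply: ler_sum => t _; have [ham|->] := weight_all_ham t dP; last by rewrite mul0r.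
rewrite ler_piMr ?weight_ge0 //; case: ifP => // _.
by apply: IH; apply: gen_PiH; apply: ham; case: (selP t N_gt0).
Qed.

Lemma sum_weight_all P (A : pred esol) :
  \sum_(t : N.-tuple esol | all A t) weight P t = (\sum_(x | A x) gen P x) ^+ N.
Proof. exact: sum_tuple_prod_all. Qed.

(** A copy of [H] among the samples keeps the level from rising, since the selected tour costs no
    more than the copy. *)
Lemma weight_no_copy_le H : is_ham n H ->
  \sum_(t : N.-tuple esol | all (predC1 H) t) weight (PiH R n H) t <= err.
Proof.
move=> hH; have [g0 _ g1] := gen_PiH hH; rewrite sum_weight_all /err.
have := g1; rewrite (bigD1 H) //= => E.
have -> : \sum_(x | x != H) gen (PiH R n H) x = 1 - gen (PiH R n H) H.
  by apply/eqP; rewrite eq_sym subr_eq addrC E.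
have c1H := gen_reproduce hH.
rewrite lerXn2r ?nnegrE ?lerD2l ?lerN2 //; last by rewrite subr_ge0 (le_trans c1H) // -E lerDl sumr_ge0.
by rewrite subr_ge0 -E lerDl sumr_ge0.
Qed.

Lemma weight_no_improvement_le H : is_ham n H -> (0 < level H)%N ->
  \sum_(t : N.-tuple esol | all (fun x => level H <= level x)%N t) weight (PiH R n H) t <= q (level H).
Proof.
move=> hH l0; have [g0 _ g1] := gen_PiH hH; rewrite sum_weight_all /q.
have := g1; rewrite (bigID (fun x => level H <= level x)%N) /= => E.
have pH := gen_improve hH l0.
have E' : \sum_(x : esol | ~~ (level H <= level x)%N) gen (PiH R n H) x =
    \sum_(H' : esol | (level H' < level H)%N) gen (PiH R n H) H'.
  by apply: eq_bigl => x; rewrite -ltnNge.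
rewrite E' in E.
have h0 : 0 <= \sum_(x : esol | (level H <= level x)%N) gen (PiH R n H) x by apply: sumr_ge0.
move: pH E h0; move: (\sum_(_ | _) _) (\sum_(_ | _) _) => x y py xy x0.
by rewrite lerXn2r ?nnegrE //; lra.
Qed.

(* [L j] iterations are budgeted for leaving level [j], of which [l] are left for the
   current level. *)
Lemma failure_prob_le M H l : is_ham n H -> (0 < level H)%N ->
  (\sum_(1 <= j < level H) L j + l <= M)%N ->
  failure_prob M (PiH R n H) <=
    err * M%:R + \sum_(1 <= j < level H) q j ^+ L j + q (level H) ^+ l.
Proof.
have sum0 k : 0 <= \sum_(1 <= j < k) q j ^+ L j by apply: sumr_ge0 => j _; rewrite exprn_ge0.
elim: M H l => [|M IH] H l hH l0.
  rewrite leqn0 addn_eq0 => /andP[_ /eqP ->]; rewrite expr0 mulr0 add0r.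
  by rewrite -[X in X <= _]add0r lerD.
case: l => [|l] Ml.
  (* With the budget of the level exhausted, [q ^+ 0 = 1] makes the bound trivial. *)
  apply: le_trans (failure_prob_le1 _ (gen_PiH hH)) _; rewrite expr0 -[X in X <= _]add0r lerD //.
  by rewrite addr_ge0 // mulr_ge0.
rewrite addnS ltnS in Ml.
rewrite failure_probS; last exact: gen_PiH.
pose P := PiH R n H; have dP : is_distribution (gen P) := gen_PiH hH.
pose U := err * M%:R + \sum_(1 <= j < level H) q j ^+ L j.
have U0 : 0 <= U by rewrite addr_ge0 // mulr_ge0.
have ql0 : 0 <= q (level H) ^+ l by rewrite exprn_ge0.
(* Without a copy of [H] the failure is bounded by 1; without improvement the level keeps [l]
   iterations; after an improvement [U] alone suffices. *)
apply: (@le_trans _ _ (\sum_t weight P t * ((all (predC1 H) t)%:R +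
    (all (fun x => level H <= level x)%N t)%:R * q (level H) ^+ l + U))); last first.
  rewrite (eq_bigr (fun t => weight P t * (all (predC1 H) t)%:R +
    (weight P t * (all (fun x => level H <= level x)%N t)%:R) * q (level H) ^+ l + weight P t * U)); last first.
    by move=> t _; ring.
  rewrite !big_split /= -!mulr_suml (sum_weight dP) mul1r.
  have indE (A : pred esol) : \sum_(t : N.-tuple esol) weight P t * (all A t)%:R =
      \sum_(t : N.-tuple esol | all A t) weight P t.
    by rewrite [RHS]big_mkcond; apply: eq_bigr => t _; case: (all A t); rewrite ?mulr1 ?mulr0.
  rewrite !indE.
  have e1 := weight_no_copy_le hH; have e2 := weight_no_improvement_le hH l0.
  have := ler_wpM2r ql0 e2; rewrite -exprS => e3.
  rewrite -natr1 mulrDr mulr1 /U.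
  move: e1 e3; rewrite -/P; lra.
apply: ler_sum => t _; have [ham|->] := weight_all_ham t dP; last by rewrite !mul0r.
rewrite ler_wpM2l ?weight_ge0 //.
have [selt selmin] := selP t N_gt0; have hs := ham _ selt.
have ind0 (b : bool) : 0 <= b%:R :> R by exact: ler0n.
case: asboolP => [_|nopt]; first by rewrite !addr_ge0 // mulr_ge0.
have ls : (0 < level (sel t))%N.
  by rewrite lt0n; apply/negP => /eqP /(optimal_level0 R n_gt2 hs).
have [noH|/allPn[x xt /negPn/eqP xH]] := boolP (all (predC1 H) t).
  apply: le_trans (failure_prob_le1 M (gen_PiH hs)) _.
  by rewrite -[X in X <= _]addr0 -addrA lerD // addr_ge0 // mulr_ge0.
subst x; rewrite add0r.
have lsle : (level (sel t) <= level H)%N := cost_le_level n_gt2 hs hH (selmin _ xt).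
have [lt|ge] := ltnP (level (sel t)) (level H).
  (* The new level starts with its full budget; the budgets of skipped levels are simply left
     over. *)
  have mono : (\sum_(1 <= j < level (sel t)) L j + L (level (sel t)) <= \sum_(1 <= j < level H) L j)%N.
    rewrite -big_nat_recr //= (big_cat_nat (ltn0Sn _) lt) //=; first exact: leq_addr.
  have monoq : \sum_(1 <= j < level (sel t)) q j ^+ L j + q (level (sel t)) ^+ L (level (sel t)) <=
      \sum_(1 <= j < level H) q j ^+ L j.
    rewrite -big_nat_recr //= (big_cat_nat (ltn0Sn _) lt) /= lerDl.
    by apply: sumr_ge0 => j _; rewrite exprn_ge0.
  apply: le_trans (IH (sel t) (L (level (sel t))) hs ls _) _.
    by apply: leq_trans Ml; apply: leq_trans mono (leq_addr _ _).
  rewrite -addrA; apply: (@le_trans _ _ U); first by rewrite /U lerD2l.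
  by rewrite lerDr mulr_ge0.
have E : level (sel t) = level H by apply/eqP; rewrite eqn_leq lsle.
have -> : all (fun x => level H <= level x)%N t.
  by apply/allP => x xt'; rewrite -E (cost_le_level n_gt2 hs (ham _ xt') (selmin _ xt')).
rewrite mul1r [X in _ <= X]addrC /U -E.
by apply: IH => //; rewrite E.
Qed.

(** Of the [T.+1] iterations, the one from [Pi0] merely supplies some tour, of level at most [n];
    the other [T] pay for the budgets. *)
Lemma find_prob_ge T : (\sum_(1 <= j < n.+1) L j <= T)%N ->
  1 - (err * T%:R + \sum_(1 <= j < n.+1) q j ^+ L j) <= find_prob R n gen N sel T (Pi0 R n).
Proof.
move=> LT; rewrite lerBlDr -lerBlDl -/(failure_prob T.+1 (Pi0 R n)).
have dP := gen_Pi0; rewrite failure_probS //.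
pose U := err * T%:R + \sum_(1 <= j < n.+1) q j ^+ L j.
rewrite -/U -[X in _ <= X]mul1r -(sum_weight dP) mulr_suml; apply: ler_sum => t _.
have [ham|->] := weight_all_ham t dP; last by rewrite !mul0r.
rewrite ler_wpM2l ?weight_ge0 //.
have [selt selmin] := selP t N_gt0; have hs := ham _ selt.
case: asboolP => [_|nopt].
  by rewrite addr_ge0 ?mulr_ge0 //; apply: sumr_ge0 => j _; rewrite exprn_ge0.
have ls : (0 < level (sel t))%N.
  by rewrite lt0n; apply/negP => /eqP /(optimal_level0 R n_gt2 hs).
have lt : (level (sel t) < n.+1)%N by rewrite ltnS level_le.
apply: le_trans (failure_prob_le (l := L (level (sel t))) hs ls _) _.
  apply: leq_trans LT; rewrite -big_nat_recr //= (big_cat_nat (ltn0Sn _) lt) //=; exact: leq_addr.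
rewrite -addrA lerD2l -big_nat_recr //= (big_cat_nat (ltn0Sn _) lt) /= lerDl.
by apply: sumr_ge0 => j _; rewrite exprn_ge0.
Qed.

End Levels.

Lemma one_sub_exp_le (R : realType) (x : R) m : 0 <= x <= 1 -> (1 - x) ^+ m <= expR (- (x * m%:R)).
Proof.
move=> /andP[x0 x1]; rewrite -mulNr expRM_natr lerXn2r ?nnegrE ?expR_ge0 ?subr_ge0 //.
exact: expR_ge1Dx.
Qed.

(** One term of the exponential series is enough: its degree [k.+1] is chosen with
    [eps * k.+1 >= 7], and the spare factor [n] beyond [n ^ 6] beats the constants. *)
Lemma polynomial_le_exp_power (R : realType) (eps c : R) : 0 < eps -> 0 < c ->
  exists n0 : nat, forall n : nat, (n0 <= n)%N -> 2 * n%:R ^+ 6 <= expR (c * n%:R `^ eps).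
Proof.
move=> eps0 c0; pose k := Num.truncn (7 / eps).
have keps : 7 <= eps * k.+1%:R.
  rewrite mulrC -ler_pdivrMr // ltW //; exact: truncnS_gt.
have ck0 : 0 < c ^+ k.+1 by rewrite exprn_gt0.
pose b := 2 * (k.+1)`!%:R / c ^+ k.+1; exists (Num.truncn b).+1 => n nb.
have bn : b <= n%:R.
  by apply: le_trans (ltW (truncnS_gt _)) _; rewrite ler_nat.
have n1 : 1 <= n%:R :> R by rewrite ler1n (leq_trans _ nb).
have n0 : 0 <= n%:R :> R by [].
have x0 : 0 <= c * n%:R `^ eps by rewrite mulr_ge0 ?powR_ge0 // ltW.
have fact0 : 0 < (k.+1)`!%:R :> R by rewrite ltr0n fact_gt0.
apply: le_trans (_ : (c * n%:R `^ eps) ^+ k.+1 / (k.+1)`!%:R <= _); last first.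
  by apply: le_trans (expR_ge1Dxn k x0); rewrite lerDr.
have pow_ge : n%:R ^+ 7 <= (n%:R `^ eps) ^+ k.+1 :> R.
  rewrite -powR_mulrn // -powR_mulrn ?powR_ge0 // -powRrM; exact: ler_powR.
rewrite ler_pdivlMr // exprMn; apply: le_trans (ler_wpM2l (ltW ck0) pow_ge).
move: bn; rewrite /b ler_pdivrMr // => bn.
rewrite (_ : 2 * _ * _ = 2 * (k.+1)`!%:R * n%:R ^+ 6); last by rewrite mulrAC.
rewrite (_ : _ * n%:R ^+ 7 = n%:R * c ^+ k.+1 * n%:R ^+ 6); last first.
  by rewrite [n%:R ^+ 7]exprS mulrA [c ^+ _ * n%:R]mulrC.
by rewrite ler_wpM2r ?exprn_ge0.
Qed.

(** * From level budgets to exponentially small failure *)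

Section Convergence.
Variables (R : realType) (N : nat -> nat) (eps c0 : R) (n1 : nat).
Hypotheses (eps_gt0 : 0 < eps) (c0_gt0 : 0 < c0).
Hypothesis N_ge : forall n : nat, (n1 <= n)%N -> c0 * n%:R `^ eps <= (N n)%:R.
Variable gen : forall n, pmat R n -> {set {set 'I_n}} -> R.
Variable sel : forall n : nat, (N n).-tuple {set {set 'I_n}} -> {set {set 'I_n}}.
Hypothesis selP : forall n, sel_ok R n (N n) (@sel n).
Variables (c1 c2 : R) (p : nat -> nat -> R) (L : nat -> nat -> nat) (T : nat -> nat).
Hypotheses (c1_gt0 : 0 < c1) (c2_gt0 : 0 < c2).
Hypothesis gen_distribution : forall n, (12 <= n)%N -> forall P : pmat R n,
  (forall i j, i != j -> 0 < P i j) -> is_distribution (gen (n := n) P).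
Hypothesis gen_reproduce : forall n H, (12 <= n)%N -> is_ham n H -> c1 <= gen (PiH R n H) H.
Hypothesis gen_improve : forall n H, (12 <= n)%N -> is_ham n H -> (0 < level H)%N ->
  p n (level H) <= \sum_(H' : {set {set 'I_n}} | (level H' < level H)%N) gen (PiH R n H) H'.
Hypothesis p01 : forall n j, (12 <= n)%N -> 0 <= p n j <= 1.
Hypothesis pL_ge : forall n j, (12 <= n)%N -> (0 < j <= n)%N -> c2 <= p n j * (L n j)%:R.
Hypothesis sumL_le : forall n, (12 <= n)%N -> (\sum_(1 <= j < n.+1) L n j <= T n)%N.
Hypothesis T_le : forall n, (12 <= n)%N -> (T n <= n ^ 6)%N.

Lemma find_prob_exponential : exists c : R, exists n0 : nat, 0 < c /\
  forall n : nat, (n0 <= n)%N ->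
    1 - expR (- c * (N n)%:R) <= find_prob R n (gen (n := n)) (N n) (@sel n) (T n) (Pi0 R n).
Proof.
(* Every error term is at most [X], with exponent [2 * c]. There are at most [T n + n <= 2 n ^ 6] of
   them, and half of the exponent pays for this number. *)
pose c := Num.min c1 c2 / 2.
have c_gt0 : 0 < c by rewrite divr_gt0 // lt_min c1_gt0.
have [n2 pol] := polynomial_le_exp_power eps_gt0 (mulr_gt0 c_gt0 c0_gt0).
exists c, (maxn 12 (maxn n1 n2)); split=> // n; rewrite !geq_max => /and3P[n12 nn1 nn2].
have n_gt2 : (2 < n)%N by apply: leq_trans n12.
have nR : 12 <= n%:R :> R by rewrite ler_nat.
have N0 : (0 < N n)%N.
  rewrite -(ltr0n R); apply: lt_le_trans (N_ge nn1).
  by rewrite mulr_gt0 // powR_gt0 // ltr0n (leq_trans _ n12).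
have dPi0 : is_distribution (gen (Pi0 R n)).
  apply: gen_distribution => // i j ij; rewrite /Pi0 (negbTE ij) divr_gt0 // subr_gt0; lra.
have dPiH H : is_ham n H -> is_distribution (gen (PiH R n H)).
  by move=> hH; apply: gen_distribution => // i j; exact: PiH_gt0.
have c1_le1 : c1 <= 1.
  have hs := is_ham_sstar n_gt2; apply: le_trans (gen_reproduce n12 hs) _.
  have [g0 _ <-] := dPiH _ hs; rewrite (bigD1 (sstar n)) //= lerDl.
  by apply: sumr_ge0.
have err0 : 0 <= (1 - c1) ^+ N n by rewrite exprn_ge0 // subr_ge0.
have q0 k : 0 <= (1 - p n k) ^+ N n.
  by rewrite exprn_ge0 // subr_ge0; case/andP: (p01 k n12).
apply: le_trans (find_prob_ge n_gt2 N0 (@selP n) dPi0 dPiH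
  (fun H => @gen_reproduce n H n12) (fun H => @gen_improve n H n12) err0 q0 (sumL_le n12)).
rewrite lerD2l lerN2.
pose X := expR (- (2 * c) * (N n)%:R).
have err_le : (1 - c1) ^+ N n <= X.
  apply: le_trans (one_sub_exp_le _ _) _; first by rewrite (ltW c1_gt0).
  rewrite ler_expR -mulNr ler_wpM2r // lerN2 /c mulrC divfK //.
  by rewrite ge_min lexx.
have q_le j : (0 < j <= n)%N -> ((1 - p n j) ^+ N n) ^+ L n j <= X.
  move=> jn; rewrite -exprM; apply: le_trans (one_sub_exp_le _ _) _; first exact: p01.
  rewrite ler_expR mulNr lerN2 mulnC natrM mulrA ler_wpM2r //.
  apply: le_trans (pL_ge n12 jn); rewrite /c mulrC divfK //.
  by rewrite ge_min lexx orbT.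
have sum_le : \sum_(1 <= j < n.+1) ((1 - p n j) ^+ N n) ^+ L n j <= n%:R * X.
  apply: (@le_trans _ _ (\sum_(1 <= j < n.+1) X)).
    by apply: ler_sum_nat => j /andP[j1 jn]; apply: q_le; rewrite j1.
  by rewrite sumr_const_nat subn1 mulr_natl.
have X0 : 0 <= X := expR_ge0 _.
have pol_n := pol n nn2.
apply: (@le_trans _ _ (2 * n%:R ^+ 6 * X)).
  have T6 : (T n)%:R <= n%:R ^+ 6 :> R by rewrite -natrX ler_nat T_le.
  have n6 : n%:R <= n%:R ^+ 6 :> R.
    by rewrite exprS ler_peMr // exprn_ege1 //; lra.
  rewrite [2 * _]mulr_natl mulr2n mulrDl; apply: lerD.
    by rewrite mulrC ler_pM.
  by apply: le_trans sum_le _; rewrite ler_wpM2r.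
apply: (@le_trans _ _ (expR (c * (N n)%:R) * X)).
  rewrite ler_wpM2r //; apply: le_trans pol_n _; rewrite ler_expR -mulrA ler_wpM2l ?(ltW c_gt0) //.
  exact: N_ge.
rewrite /X -expRD ler_expR; lra.
Qed.

End Convergence.

(** * Harmonic sums and the budgets of the edge-based case *)

Lemma harmonic_le_ln (R : realType) n : (0 < n)%N ->
  \sum_(1 <= j < n.+1) (j%:R : R)^-1 <= 1 + ln n%:R.
Proof.
elim: n => // -[|n] IH _; first by rewrite big_nat1 invr1 ln1 addr0.
rewrite big_nat_recr //=; apply: le_trans (lerD (IH isT) (lexx _)) _.
have n1 : 0 < n.+1%:R :> R by [].
have n2 : 0 < n.+2%:R :> R by [].
rewrite -addrA lerD2l -lerBrDl -lerN2 opprB -ln_div ?posrE //.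
have -> : n.+1%:R / n.+2%:R = 1 + - n.+2%:R^-1 :> R.
  rewrite -[n.+2%:R]natr1; move: (n.+1%:R : R) n1 => x x0; field.
  by rewrite gt_eqF // addr_gt0.
apply: le_ln1Dx; rewrite ltrN2 invf_lt1 // ltr1n //.
Qed.

Lemma ln_ge1 (R : realType) n : (4 <= n)%N -> 1 <= ln (n%:R : R).
Proof.
move=> n4; apply: (@le_trans _ _ (ln (4 : R))); last first.
  by rewrite ler_ln ?posrE ?ltr0n ?ler_nat // (leq_trans _ n4).
have -> : (4 : R) = 2 ^+ 2 by rewrite -natrX.
rewrite lnXn // mulr2n.
have : - ln (2 : R) <= - 2^-1.
  rewrite -lnV ?posrE // [X in ln X](_ : _ = 1 + - 2^-1); last by field.
  by apply: le_ln1Dx; rewrite ltrN2 invf_lt1 // ltr1n.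
lra.
Qed.

(** The 2 in the budgets absorbs the additive 1 of the harmonic bound, as [1 + ln n <= 2 * ln n]. *)
Lemma half_cube_div_sum_le (R : realType) n : (12 <= n)%N ->
  (\sum_(1 <= j < n.+1) n ^ 3 %/ (2 * j) <= Num.truncn (n%:R ^+ 3 * ln n%:R : R))%N.
Proof.
move=> n12; have n0 : (0 < n)%N by apply: leq_trans n12.
have ln1 : 1 <= ln (n%:R : R) by apply: ln_ge1; apply: leq_trans n12.
have n3 : 0 <= n%:R ^+ 3 :> R by rewrite exprn_ge0.
rewrite truncn_ge_nat; last by rewrite mulr_ge0 // (le_trans _ ln1).
apply: (@le_trans _ _ (\sum_(1 <= j < n.+1) n%:R ^+ 3 / 2 * (j%:R : R)^-1)).
  rewrite natr_sum; apply: ler_sum_nat => j /andP[j1 _].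
  have j0 : 0 < 2 * j%:R :> R by rewrite mulr_gt0 // ltr0n.
  rewrite -mulrA -invfM ler_pdivlMr // -natrM -natrM -natrX ler_nat.
  exact: leq_trunc_div.
rewrite -mulr_sumr; apply: le_trans (ler_wpM2l _ (harmonic_le_ln R n0)) _; first by rewrite divr_ge0.
rewrite -mulrA ler_wpM2l // ler_pdivrMl //; lra.
Qed.

Lemma truncn_cube_ln_le (R : realType) n : (12 <= n)%N ->
  (Num.truncn (n%:R ^+ 3 * ln n%:R : R) <= n ^ 6)%N.
Proof.
move=> n12; have n1 : 1 <= n%:R :> R by rewrite ler1n (leq_trans _ n12).
have ln1 : 1 <= ln (n%:R : R) by apply: ln_ge1; apply: leq_trans n12.
have n3 : 0 <= n%:R ^+ 3 :> R by rewrite exprn_ge0.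
rewrite -(ler_nat R) natrX; apply: (@le_trans _ _ (n%:R ^+ 3 * ln n%:R)).
  by rewrite truncn_le mulr_ge0 // (le_trans _ ln1).
rewrite -[6%N]/(3 + 3)%N exprD ler_wpM2l //.
apply: le_trans (ltW (ln_sublinear _)) _; first exact: lt_le_trans n1.
by rewrite exprS ler_peMr ?exprn_ege1 // (le_trans _ n1).
Qed.

(** Rounding down loses less than [2 * j <= 2 * n], which is small against [n ^ 3]. *)
Lemma quarter_cube_le n j : (12 <= n)%N -> (0 < j <= n)%N ->
  (n ^ 3 <= 4 * (j * (n ^ 3 %/ (2 * j))))%N.
Proof.
move=> n12 /andP[j0 jn].
have n3 : (48 * n <= n ^ 3)%N by rewrite expnSr leq_mul2r -mulnn; nia.
have j2 : (0 < 2 * j)%N by rewrite muln_gt0.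
have := divn_eq (n ^ 3) (2 * j); have := ltn_pmod (n ^ 3) j2.
move: n3; move: (n ^ 3)%N (_ %/ _)%N (_ %% _)%N => a b r; nia.
Qed.

Theorem theorem2 (R : realType) (N : nat -> nat) (eps : R) :
  0 < eps < 1 ->
  (exists c0 : R, exists n1 : nat, 0 < c0 /\
     forall n : nat, (n1 <= n)%N -> c0 * (n%:R `^ eps) <= (N n)%:R) ->
  (forall sel : forall n : nat, (N n).-tuple {set {set 'I_n}} -> {set {set 'I_n}},
     (forall n, sel_ok R n (N n) (sel n)) ->
     exists c : R, exists n0 : nat, 0 < c /\
       forall n : nat, (n0 <= n)%N ->
         1 - expR (- c * (N n)%:R)
           <= find_prob R n (vgen R n) (N n) (sel n) (expn n 6) (Pi0 R n))
  /\
  (forall sel : forall n : nat, (N n).-tuple {set {set 'I_n}} -> {set {set 'I_n}},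
     (forall n, sel_ok R n (N n) (sel n)) ->
     exists c : R, exists n0 : nat, 0 < c /\
       forall n : nat, (n0 <= n)%N ->
         1 - expR (- c * (N n)%:R)
           <= find_prob R n (egen R n) (N n) (sel n)
                (Num.truncn ((n%:R) ^+ 3 * ln (n%:R) : R)) (Pi0 R n)).
Proof.
move=> /andP[eps0 _] [c0 [n1 [c0_gt0 N_ge]]]; split=> sel selP.
(* Here [p * L] is exactly [expR (- 2) / 8], and [n] levels with [n ^ 5] iterations each give
   [n ^ 6]. *)
- apply: (@find_prob_exponential R N eps c0 n1 eps0 c0_gt0 N_ge (vgen R) sel selP
    (expR (- 2) / 2) (expR (- 2) / 8) (fun n _ => expR (- 2) / (8 * n%:R ^+ 5))
    (fun n _ => n ^ 5)%N (fun n => n ^ 6)%N) => //.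
  + move=> n n12 P P0; have n2 : (2 < n)%N by apply: leq_trans n12.
    split; [exact: vgen_ge0 | exact: vgen_not_ham | exact: sum_vgen_all].
  + by move=> n H n12 hH; exact: vgen_reproduce_ge.
  + by move=> n H n12 hH; exact: vgen_improve_ge.
  + move=> n j n12; have n1' : 1 <= n%:R :> R by rewrite ler1n (leq_trans _ n12).
    rewrite divr_ge0 ?expR_ge0 ?mulr_ge0 ?exprn_ge0 //= ler_pdivrMr ?mulr_gt0 ?exprn_gt0 ?(lt_le_trans _ n1') //.
    rewrite mul1r; apply: (@le_trans _ _ 1); first by rewrite expR_le1 oppr_le0.
    by rewrite mulr_ege1 ?exprn_ege1 // ler1n.
  + move=> n j n12 _; rewrite natrX le_eqVlt; apply/orP; left; apply/eqP.
    have n0 : n%:R != 0 :> R by rewrite pnatr_eq0 -lt0n (leq_trans _ n12).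
    by field.
  + by move=> n _; rewrite sum_nat_const_nat subn1 -expnS.
(* [minn j n] keeps [p] at most 1 for every [j], while levels never exceed [n]. The 64 is 16 from
   [egen_improve_ge] times 4 from [quarter_cube_le]. *)
- apply: (@find_prob_exponential R N eps c0 n1 eps0 c0_gt0 N_ge (egen R) sel selP
    (expR (- 8)) (expR (- 8) / 64) (fun n j => (minn j n)%:R * expR (- 8) / (16 * n%:R ^+ 3))
    (fun n j => n ^ 3 %/ (2 * j))%N (fun n => Num.truncn ((n%:R) ^+ 3 * ln (n%:R) : R))) => //.
  + move=> n n12 P P0; have n2 : (2 < n)%N by apply: leq_trans n12.
    split; [exact: egen_ge0 | exact: egen_not_ham | exact: sum_egen_all].
  + by move=> n H n12 hH; exact: egen_reproduce_ge.
  + move=> n H n12 hH _; rewrite (minn_idPl (level_le hH)); exact: egen_improve_ge.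
  + move=> n j n12; have n1' : 1 <= n%:R :> R by rewrite ler1n (leq_trans _ n12).
    rewrite divr_ge0 ?mulr_ge0 ?expR_ge0 ?exprn_ge0 //= ler_pdivrMr ?mulr_gt0 ?exprn_gt0 ?(lt_le_trans _ n1') //.
    rewrite mul1r [_ * expR _]mulrC; apply: ler_pM; rewrite ?expR_ge0 //.
      by apply: (@le_trans _ _ 1); rewrite ?expR_le1 ?oppr_le0 ?ler1n.
    rewrite -natrX ler_nat (leq_trans (geq_minr _ _)) // -[X in (X <= _)%N]expn1.
    by rewrite leq_pexp2l // (leq_trans _ n12).
  + move=> n j n12 jn; have /andP[_ /minn_idPl ->] := jn.
    have n0 : 0 < n%:R :> R by rewrite ltr0n (leq_trans _ n12).
    have := quarter_cube_le n12 jn; rewrite -(ler_nat R) natrX !natrM.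
    move: (_ %/ _)%N => m; move: (expR (- 8)) (expR_gt0 (- 8 : R)) => E E0 q.
    rewrite [X in _ <= X]mulrAC ler_pdivlMr ?mulr_gt0 ?exprn_gt0 //.
    move: (ler_wpM2l (ltW E0) q); move: (n%:R ^+ 3 : R) (j%:R : R) (m%:R : R) => x y z.
    lra.
  + by move=> n n12; exact: half_cube_div_sum_le.
  + by move=> n n12; exact: truncn_cube_ln_le.
Qed.
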